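(* Let $X$ be a Banach space with basis $(x_i)_{i=1}^\infty$. Then every normalized block tree on $X$ with respect to $(x_i)$ has a good branch if and only if $X$ is $1$-asymptotic $\ell_p$ (with respect to $(x_i)$) for some $1\leq p\leq\infty$. In particular, such a space contains almost isometric copies of $\ell_p$ (or of $c_0$ in the case $p=\infty$); that is, for every $\epsilon>0$, $X$ contains a sequence which is $(1+\epsilon)$-equivalent to the unit vector basis of $\ell_p$ (of $c_0$ in the case $p=\infty$).
   Context: Scalars are real; bases and basic sequences are Schauder. Equivalence: for $C\geq 1$, two sequences $(u_i)$, $(v_i)$ (finite of the same length, or both infinite) are $C$-equivalent if $\frac1C\|\sum a_i v_i\|\leq\|\sum a_i u_i\|\leq C\|\sum a_i v_i\|$ for all finitely supported scalars $(a_i)$. For a finite-dimensional space $E$ with a fixed basis $(e_i)_{i=1}^n$, $E\stackrel{C}{\sim}\ell_p^n$ means that $(e_i)_{i=1}^n$ is $C$-equivalent to the unit vector basis of $\ell_p^n$. A block (basic) sequence of $(x_i)$ is a finite or infinite sequence of nonzero finitely supported vectors $y_j$ in the span of $(x_i)$ with $\max\operatorname{supp}(y_j)<\min\operatorname{supp}(y_{j+1})$, supports being taken with respect to $(x_i)$. Good sequence: a normalized basic sequence $(y_i)$ is good if for every $n\in\mathbb{N}$ and all scalars $(a_i)_{i=1}^n$ the limit $\lim_{k_1\to\infty}\|\sum_{i=1}^n a_i y_{k_i}\|$ (over $k_1<k_2<\cdots<k_n$) exists. Trees: $[\mathbb{N}]^{<\omega}$ is the collection of finite subsets of $\mathbb{N}$.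 A tree on $X$ is a family $(x_A)_{A\in[\mathbb{N}]^{<\omega}}$ with $x_\emptyset=\emptyset$ and $x_A\in X$ for $A\neq\emptyset$ (the $x_A$ are called nodes). A branch is a sequence $(x_{\{k_1,\ldots,k_n\}})_{n=1}^\infty$ where $k_1<k_2<\cdots$ are natural numbers. The sequence of nodes below $A$ is $(x_{A\cup\{n\}})_{n>\max A}$, in increasing order of $n$ (all $n\in\mathbb{N}$ if $A=\emptyset$). The tree is normalized if every node $x_A$, $A\ne\emptyset$, has norm $1$; it is a block tree with respect to $(x_i)$ if for every $A\in[\mathbb{N}]^{<\omega}$ the sequence of nodes below $A$ is a block basic sequence of $(x_i)$. Asymptotic structure: let $S(Y)$ denote the unit sphere of $Y$ and $[x_i]_{i=m}^\infty$ the closed linear span of $\{x_i:i\geq m\}$. An $n$-dimensional Banach space $E$ with basis $(e_i)_{i=1}^n$ is an asymptotic space for $X$ (relative to $(x_i)$) if for every $\epsilon>0$: $\forall m_1\in\mathbb{N}\ \exists y_1\in S([x_i]_{i=m_1}^\infty)\ \cdots\ \forall m_n\in\mathbb{N}\ \exists y_n\in S([x_i]_{i=m_n}^\infty)$ such that $(y_i)_{i=1}^n$ is a block sequence of $(x_i)$ and is $(1+\epsilon)$-equivalent to $(e_i)_{i=1}^n$. The collection of these is denoted $\{X\}_n$. $X$ is $C$-asymptotic $\ell_p$ if for all $n\in\mathbb{N}$ and all $E\in\{X\}_n$ we have $E\stackrel{C}{\sim}\ell_p^n$. *)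

(* Defs.v *)
From mathcomp Require Import all_boot all_order all_algebra.
From mathcomp Require Import finmap.
From mathcomp Require Import all_classical all_reals all_analysis.
Set Implicit Arguments.
Unset Strict Implicit.
Unset Printing Implicit Defensive.
Import Order.TTheory GRing.Theory Num.Theory.
Import numFieldNormedType.Exports.
Local Open Scope classical_set_scope.
Local Open Scope ring_scope.

(* Sequences are indexed from 0: x_{i+1} of the usual notation is [x i], and
   the natural numbers labelling trees start at 0.  A sequence of length n is a
   function on ['I_n]. *)

(** Bases and closed linear spans *)

Definition lin_span (R : realType) (X : normedModType R) (x : nat -> X)
    (m : nat) : set X :=
  [set v | exists (N : nat) (a : nat -> R),
             v = \sum_(m <= i < N) a i *: x i].

Definition closed_span (R : realType) (X : normedModType R) (x : nat -> X)
    (m : nat) : set X :=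
  closure (lin_span x m).

Definition schauder_basis_of (R : realType) (X : normedModType R) (V : set X)
    (x : nat -> X) : Prop :=
  (forall i, V (x i)) /\
  (forall v, V v ->
     exists! a : nat -> R, series (fun i => a i *: x i) @ \oo --> v).

Definition schauder_basis (R : realType) (X : normedModType R)
    (x : nat -> X) : Prop :=
  schauder_basis_of setT x.

Definition basic_sequence (R : realType) (X : normedModType R)
    (y : nat -> X) : Prop :=
  schauder_basis_of (closed_span y 0) y.

(* In particular E has dimension n. *)
Definition finite_basis (R : realType) (E : normedModType R) (n : nat)
    (e : 'I_n -> E) : Prop :=
  forall v, exists! a : 'I_n -> R, v = \sum_(i < n) a i *: e i.

(** Equivalence *)

Definition comb_norm (R : realType) (X : normedModType R) (n : nat)
    (u : 'I_n -> X) (a : 'I_n -> R) : R :=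
  `|\sum_(i < n) a i *: u i|.

(* For p = +oo this is also the norm of c_0 on its first n coordinates.  The
   value at p = -oo is irrelevant: p is always at least 1 below. *)
Definition lp_norm (R : realType) (p : \bar R) (n : nat)
    (a : 'I_n -> R) : R :=
  match p with
  | r%:E => (\sum_(i < n) `|a i| `^ r) `^ r^-1
  | +oo%E => \big[Num.max/0]_(i < n) `|a i|
  | -oo%E => 0
  end.

(* A sequence enters C-equivalence only through the norms of its linear
   combinations, [comb_norm u a] for vectors u in a normed space and
   [lp_norm p a] for the unit vector basis of l_p (or c_0). *)
Definition equivalent (R : realType) (C : R) (n : nat)
    (N M : ('I_n -> R) -> R) : Prop :=
  forall a, C^-1 * M a <= N a <= C * M a.

Definition equivalent_to_lpn (R : realType) (X : normedModType R) (C : R)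
    (p : \bar R) (n : nat) (u : 'I_n -> X) : Prop :=
  equivalent C (comb_norm u) (@lp_norm R p n).

(* A finitely supported scalar sequence lives on the first n indices for some
   n. *)
Definition equivalent_to_lp (R : realType) (X : normedModType R) (C : R)
    (p : \bar R) (u : nat -> X) : Prop :=
  forall n, equivalent_to_lpn C p (fun i : 'I_n => u i).

(** Block sequences *)

Definition finite_expansion (R : realType) (X : normedModType R)
    (x : nat -> X) (a : nat -> R) (v : X) : Prop :=
  exists N, (forall i, (N <= i)%N -> a i = 0) /\
            v = \sum_(0 <= i < N) a i *: x i.

(* max supp u < min supp v; the expansions a and b are unique when x is a
   basis. *)
Definition successive (R : realType) (X : normedModType R)
    (x : nat -> X) (u v : X) : Prop :=
  exists a b : nat -> R,
    [/\ finite_expansion x a u, finite_expansion x b v &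
        forall i j, a i != 0 -> b j != 0 -> (i < j)%N].

Definition finite_block_sequence (R : realType) (X : normedModType R)
    (x : nat -> X) (n : nat) (y : 'I_n -> X) : Prop :=
  (forall i, y i != 0 /\ exists a, finite_expansion x a (y i)) /\
  (forall i j : 'I_n, j = i.+1 :> nat -> successive x (y i) (y j)).

Definition block_sequence (R : realType) (X : normedModType R)
    (x : nat -> X) (y : nat -> X) : Prop :=
  (forall i, y i != 0 /\ exists a, finite_expansion x a (y i)) /\
  (forall i, successive x (y i) (y i.+1)).

(** Good sequences *)

Definition good_sequence (R : realType) (X : normedModType R)
    (y : nat -> X) : Prop :=
  [/\ forall i, `|y i| = 1,
      basic_sequence y &
      forall (n : nat) (a : 'I_n -> R), exists L : R,
        forall eps : R, 0 < eps -> exists K : nat,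
          forall k : 'I_n -> nat,
            (forall i j : 'I_n, (i < j)%N -> (k i < k j)%N) ->
            (forall i, (K <= k i)%N) ->
            `| `|\sum_(i < n) a i *: y (k i)| - L | < eps].

(** Trees.  A tree is a function [T : {fset nat} -> X]; its value at the empty
    set is a placeholder for the root, which is not a vector, and is never
    used. *)

Definition branch (R : realType) (X : normedModType R)
    (T : {fset nat} -> X) (k : nat -> nat) : nat -> X :=
  fun n => T [fset k i | i in iota 0 n.+1]%fset.

(* The starting label is (max A) + 1, and 0 when A is empty. *)
Definition nodes_below (R : realType) (X : normedModType R)
    (T : {fset nat} -> X) (A : {fset nat}) : nat -> X :=
  fun n => T ((\max_(i <- A) i.+1 + n)%N |` A)%fset.

Definition normalized_tree (R : realType) (X : normedModType R)
    (T : {fset nat} -> X) : Prop :=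
  forall A : {fset nat}, A != fset0 -> `|T A| = 1.

Definition block_tree (R : realType) (X : normedModType R)
    (x : nat -> X) (T : {fset nat} -> X) : Prop :=
  forall A : {fset nat}, block_sequence x (nodes_below T A).

Definition has_good_branch (R : realType) (X : normedModType R)
    (T : {fset nat} -> X) : Prop :=
  exists k : nat -> nat,
    (forall i j, (i < j)%N -> (k i < k j)%N) /\ good_sequence (branch T k).

(** Asymptotic structure *)

Definition tail_sphere (R : realType) (X : normedModType R)
    (x : nat -> X) (m : nat) : set X :=
  [set v | closed_span x m v /\ `|v| = 1].

(* forall m_1, exists y_1 in S m_1, ..., forall m_n, exists y_n in S m_n,
   P [:: y_1; ...; y_n], the vectors already chosen being stored in [acc]. *)
Fixpoint alternating (T : Type) (S : nat -> set T) (P : seq T -> Prop)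
    (n : nat) (acc : seq T) : Prop :=
  match n with
  | 0%N => P acc
  | n'.+1 => forall m : nat, exists y : T,
               S m y /\ alternating S P n' (rcons acc y)
  end.

Definition asymptotic_space (R : realType) (X : normedModType R)
    (x : nat -> X) (E : normedModType R) (n : nat) (e : 'I_n -> E) : Prop :=
  forall eps : R, 0 < eps ->
    alternating (tail_sphere x)
      (fun s => let y := fun i : 'I_n => nth 0 s i in
         finite_block_sequence x y /\
         equivalent (1 + eps) (comb_norm y) (comb_norm e))
      n [::].

Definition asymptotic_lp (R : realType) (X : normedModType R)
    (x : nat -> X) (C : R) (p : \bar R) : Prop :=
  forall (n : nat) (E : completeNormedModType R) (e : 'I_n -> E),
    finite_basis e -> asymptotic_space x e -> equivalent_to_lpn C p e.

(* Main.v *)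
Require Import Defs.
From HB Require Import structures.
From mathcomp Require Import all_boot all_order all_algebra.
From mathcomp Require Import finmap.
From mathcomp Require Import all_classical all_reals all_analysis.
From mathcomp Require Import ring lra zify.
Import Order.TTheory GRing.Theory Num.Theory.
Import numFieldNormedType.Exports.
Local Open Scope classical_set_scope.
Local Open Scope ring_scope.

(** Only pairs of vectors matter.  Let [N] be a norm on the plane and call [x]
    asymptotically [N] when, for every [eps], all pairs of finitely supported
    unit vectors [y], [w], with [y] far out and [w] far beyond [y], are
    [(1 + eps)]-equivalent to the basis of [(R^2, N)] ([asymptotic_pair]).  The
    three properties of the theorem are compared through this notion.

    Suppose that all normalized block trees have good branches.  A good branch
    of the tree of normalized basis vectors is a good sequence [z]; let [N] be
    the limit of the norms of its pairs.  If arbitrarily far out there were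
    pairs not close to [N], a tree could be built which alternates nodes taken
    from [z] with such pairs.  On a good branch of it the norms of all the pairs
    have a common limit, which is [N] because of the nodes taken from [z]; the
    convergence is uniform on the unit ball of the plane ([pair_limit_uniform]),
    a contradiction.  So [x] is asymptotically [N]
    ([good_branches_asymptotic_pair]).

    Such an [N] is invariant under changes of signs, since unit spheres are, and
    associative: [N (N a b) c] and [N a (N b c)] are both approximated by the
    norm of [a y1 + b y2 + c y3], because the normalization of [a y1 + b y2], or
    of [b y2 + c y3], is again a unit vector far out.  By an argument that goes
    back to Bohnenblust, [N] is then an l_p norm ([associative_norm_lp]): the
    norm [lam n] of the sum of n unit basis vectors is multiplicative and
    nondecreasing in n, hence constant or a power of n.

    Conversely, suppose that [x] is asymptotically l_p in this sense.  A
    combination of vectors [u 0], [u 1], ... chosen far out can be evaluated by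
    splitting off [u 0] from all the rest, then [u 1] from all the rest, and so
    on, with errors that depend on [u 0], [u 1], ... and can be prescribed in
    advance.  This gives almost isometric copies of l_p, good branches in all
    block trees, and the isometric identification of all asymptotic spaces
    ([chain_equivalent], [far_requirement]).

    It remains to see that a 1-asymptotic l_p space is asymptotically l_p on
    pairs ([asymptotic_lp_pair]).  Otherwise an ultrafilter on the far out pairs
    which are not close to l_p has a limit norm, which is a two-dimensional
    asymptotic space; it is l_p by assumption, but most of the pairs are close
    to their limit.

    The estimates use that the partial sum projections of a Schauder basis are
    uniformly bounded ([psum_bounded]); this is deduced from the Baire category
    theorem. *)

Set Implicit Arguments.
Unset Strict Implicit.
Unset Printing Implicit Defensive.

Lemma cvg_seqP (R : realType) (V : normedModType R) (u : nat -> V) (l : V) :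
  (u @ \oo --> l) <->
  (forall e : R, 0 < e -> exists N, forall n, (N <= n)%N -> `|l - u n| < e).
Proof.
split=> [/cvgrPdist_lt h e e0|h].
  by have [N _ hN] := h e e0; exists N.
apply/cvgrPdist_lt => e e0; have [N hN] := h e e0.
by exists N.
Qed.

(** * Coefficients and projections of a Schauder basis *)

(** The coefficient sequence of [v] with respect to [x]; when [x] is a
    Schauder basis it is the only one whose series converges to [v]. *)
Definition coef (R : realType) (X : normedModType R) (x : nat -> X) (v : X) :
    nat -> R :=
  xget (fun=> 0) [set a | series (fun i => a i *: x i) @ \oo --> v].

(** The partial sum projection onto the span of the first [n] vectors. *)
Definition psum (R : realType) (X : normedModType R) (x : nat -> X) (n : nat)
    (v : X) : X :=
  \sum_(0 <= i < n) coef x v i *: x i.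

Section Basis.
Context (R : realType) (X : completeNormedModType R) (x : nat -> X).
Hypothesis hx : schauder_basis x.
Implicit Types (u v w : X) (a b : nat -> R) (m n i j : nat).

Lemma psum_cvg v : (fun n => psum x n v) @ \oo --> v.
Proof.
have [a [ha _]] := (proj2 hx) v I.
exact: (@xgetPex _ (fun=> 0) [set a | series (fun i => a i *: x i) @ \oo --> v]
  (ex_intro _ a ha)).
Qed.

Lemma coef_unique a v :
  (fun n => \sum_(0 <= i < n) a i *: x i) @ \oo --> v -> coef x v = a.
Proof.
have [b [_ hb]] := (proj2 hx) v I.
by move=> ha; rewrite -(hb _ (@psum_cvg v)) -(hb a).
Qed.

Lemma coef_linear (c : R) u v :
  coef x (c *: u + v) = (fun i => c * coef x u i + coef x v i).
Proof.
apply: coef_unique.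
have -> : (fun n => \sum_(0 <= i < n) (c * coef x u i + coef x v i) *: x i) =
          (fun n => c *: psum x n u + psum x n v).
  apply/funext => n; rewrite /psum scaler_sumr -big_split/=.
  by apply: eq_bigr => i _; rewrite scalerDl scalerA.
by apply: cvgD; [apply: cvgZl_tmp; exact: psum_cvg|exact: psum_cvg].
Qed.

Lemma coef_add u v i : coef x (u + v) i = coef x u i + coef x v i.
Proof. by rewrite -[u]scale1r coef_linear mul1r scale1r. Qed.

Lemma coef_zero i : coef x 0 i = 0.
Proof. by apply: (addrI (coef x 0 i)); rewrite -coef_add !addr0. Qed.

Lemma coef_scale (c : R) u i : coef x (c *: u) i = c * coef x u i.
Proof. by rewrite -[c *: u]addr0 coef_linear coef_zero addr0. Qed.

Lemma coef_opp u i : coef x (- u) i = - coef x u i.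
Proof. by rewrite -scaleN1r coef_scale mulN1r. Qed.

Lemma coef_bigsum (I : Type) (r : seq I) (P : pred I) (F : I -> X) i :
  coef x (\sum_(k <- r | P k) F k) i = \sum_(k <- r | P k) coef x (F k) i.
Proof.
apply: (big_morph (fun v => coef x v i)); [exact: (fun u v => coef_add u v i)|].
exact: coef_zero.
Qed.

Lemma psum_linear n (c : R) u v :
  psum x n (c *: u + v) = c *: psum x n u + psum x n v.
Proof.
rewrite /psum scaler_sumr -big_split/=; apply: eq_bigr => i _.
by rewrite coef_linear scalerDl scalerA.
Qed.

Lemma psum0 n : psum x n 0 = 0.
Proof. by rewrite /psum big1// => i _; rewrite coef_zero scale0r. Qed.

Lemma psumD n u v : psum x n (u + v) = psum x n u + psum x n v.
Proof. by rewrite -[u]scale1r psum_linear !scale1r. Qed.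

Lemma psumZ n (c : R) u : psum x n (c *: u) = c *: psum x n u.
Proof. by rewrite -[c *: u]addr0 psum_linear psum0 addr0. Qed.

Lemma psumN n u : psum x n (- u) = - psum x n u.
Proof. by rewrite -scaleN1r psumZ scaleN1r. Qed.

Lemma psumB n u v : psum x n (u - v) = psum x n u - psum x n v.
Proof. by rewrite psumD psumN. Qed.

(** By Baire's theorem, one of the sets [B k] of the vectors whose partial sums
    are all bounded by [k] is dense in a ball; since it is symmetric and convex,
    multiples of it are dense around 0. *)
Lemma approx_psum_bounded :
  exists C : R, 0 < C /\ forall v, exists w, `|v - w| <= `|v| / 2 /\
    forall n, `|psum x n w| <= C * `|v|.
Proof.
pose B (k : nat) := [set v : X | forall n, `|psum x n v| <= k%:R].
have [k [v0 [r [r0 hr]]]] : exists k v0 (r : R), 0 < r /\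
    forall v, `|v0 - v| < r -> closure (B k) v.
  apply: contrapT => hno.
  have dF k : open (~` closure (B k)) /\ dense (~` closure (B k)).
    split; first exact/closed_openC/closed_closure.
    move=> O [v0 Ov0] oO.
    have /nbhs_ballP[r /= r0 hr] : nbhs v0 O by exact: open_nbhs_nbhs.
    apply: contrapT => hn; apply: hno; exists k, v0, r; split=> // v hv.
    apply: contrapT => nB; apply: hn; exists v; split=> //.
    by apply: hr; rewrite -ball_normE.
  have [v [_ hv]] := @Baire R X _ dF setT (ex_intro _ 0 I) openT.
  have /cvg_seq_bounded/pinfty_ex_gt0[M M0 hM] : cvg ((fun n => psum x n v) @ \oo).
    by apply/cvg_ex; exists v; exact: psum_cvg.
  apply: (hv (Num.truncn M).+1 I); apply: subset_closure => n /=.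
  apply: le_trans (hM n I) _.
  by apply: ltW; rewrite truncnS_gt.
have clB v e : closure (B k) v -> 0 < e -> exists2 w, B k w & `|v - w| < e.
  move=> cv e0; have [|w [Bw hw]] := cv (ball v e); first exact: nbhsx_ballx.
  by exists w => //; rewrite -ball_normE in hw.
have small v e : `|v| < r -> 0 < e -> exists2 w, B k w & `|v - w| <= e.
  move=> vr e0.
  have [w1 B1 h1] : exists2 w, B k w & `|v0 + v - w| < e.
    by apply: clB => //; apply: hr; rewrite opprD addNKr normrN.
  have [w2 B2 h2] : exists2 w, B k w & `|v0 - v - w| < e.
    by apply: clB => //; apply: hr; rewrite opprB addrC subrK.
  exists (2^-1 *: (w1 - w2)).
    move=> n; rewrite psumZ psumB normrZ gtr0_norm ?invr_gt0//.
    have := ler_normB (psum x n w1) (psum x n w2).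
    have := B1 n; have := B2 n => /=; lra.
  have -> : v - 2^-1 *: (w1 - w2) = 2^-1 *: ((v0 + v - w1) - (v0 - v - w2)).
    have -> : (v0 + v - w1) - (v0 - v - w2) = 2 *: v - (w1 - w2).
      rewrite scaler_nat mulr2n !opprB (AC (3*(1*2)) ((2*5)*(4*3)*(1*6)))/=.
      by rewrite subrr addr0.
    by rewrite [RHS]scalerBr scalerA mulVf// scale1r.
  rewrite normrZ gtr0_norm ?invr_gt0//.
  have := ler_normB (v0 + v - w1) (v0 - v - w2); lra.
exists (2 * k%:R / r + 1); split.
  by rewrite ltr_wpDl// divr_ge0// ?mulr_ge0// ltW.
move=> v; have [->|v0'] := eqVneq v 0.
  exists 0; rewrite subrr normr0 mul0r; split=> // n.
  by rewrite psum0 normr0 mulr0.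
have nv : 0 < `|v| by rewrite normr_gt0.
pose s := r / 2 / `|v|.
have s0 : 0 < s by rewrite !divr_gt0.
have [||w Bw hw] := small (s *: v) (s * (`|v| / 2)).
- rewrite normrZ gtr0_norm// /s divfK ?gt_eqF//; lra.
- by rewrite mulr_gt0// divr_gt0.
exists (s^-1 *: w); split.
  have -> : v - s^-1 *: w = s^-1 *: (s *: v - w).
    by rewrite [RHS]scalerBr scalerA mulVf ?gt_eqF// scale1r.
  by rewrite normrZ gtr0_norm ?invr_gt0// ler_pdivrMl.
move=> n; rewrite psumZ normrZ gtr0_norm ?invr_gt0// ler_pdivrMl//.
apply: le_trans (Bw n) _ => /=.
have -> : s * ((2 * k%:R / r + 1) * `|v|) = k%:R + r / 2.
  rewrite /s; field.
  by rewrite !gt_eqF.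
lra.
Qed.

Lemma basis_neq0 i : x i != 0.
Proof.
apply/eqP => xi0.
have h0 : coef x 0 = (fun j => (j == i)%:R).
  apply: coef_unique; apply/cvg_seqP => e e0; exists 0%N => n _.
  rewrite big1 ?subrr ?normr0// => j _.
  by case: eqP => [->|_]; rewrite ?xi0 ?scaler0 ?scale0r.
by have := coef_zero i; rewrite h0 eqxx => /eqP; rewrite oner_eq0.
Qed.

Lemma psumS n v : psum x n.+1 v = psum x n v + coef x v n *: x n.
Proof. by rewrite /psum big_nat_recr. Qed.

Lemma cvg_dist_le (V : normedModType R) (u : nat -> V) (l w : V) (b : R) N :
  u @ \oo --> l -> (forall n, (N <= n)%N -> `|u n - w| <= b) -> `|l - w| <= b.
Proof.
move=> /cvg_seqP ul hb; apply/ler_addgt0Pr => e e0.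
have [M hM] := ul e e0.
have h1 := hM (maxn M N) (leq_maxl _ _).
have h2 := hb (maxn M N) (leq_maxr _ _).
have := ler_normD (l - u (maxn M N)) (u (maxn M N) - w).
rewrite addrA subrK; lra.
Qed.

(** Banach's theorem: the partial sum projections are uniformly bounded.  A
    vector [v] is the sum of the successive approximations [g (r j)], whose
    partial sums are bounded by a geometric sequence; summing the coefficients
    of these approximations gives an expansion of [v], which by uniqueness is
    the expansion of [v]. *)
Theorem psum_bounded :
  exists K : R, 0 <= K /\ forall n v, `|psum x n v| <= K * `|v|.
Proof.
have [C [C0 hC]] := approx_psum_bounded.
have [g hg] := choice hC.
exists (2 * C); split=> [|n0 v]; first lra.
pose r j := iter j (fun w => w - g w) v.
have rS j : r j.+1 = r j - g (r j) by [].
have rle j : `|r j| <= `|v| * 2^-1 ^+ j.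
  elim: j => [|j ih]; first by rewrite expr0 mulr1.
  rewrite rS exprSr; have [h _] := hg (r j); lra.
have gle j n : `|psum x n (g (r j))| <= C * (`|v| * 2^-1 ^+ j).
  by apply: le_trans (proj2 (hg (r j)) n) _; rewrite ler_wpM2l// ltW.
pose S J := \sum_(0 <= j < J) g (r j).
have SE J : v - S J = r J.
  elim: J => [|J ih]; first by rewrite /S big_nil subr0.
  by rewrite rS /S big_nat_recr//= opprD addrA -/(S J) ih.
pose c i := [sequence coef x (g (r j)) i]_j.
have cvgc i : cvg (series (c i) @ \oo).
  apply: normed_cvg.
  apply: (@series_le_cvg _ _ (geometric (2 * C * `|v| / `|x i|) 2^-1)).
  - by move=> j /=.
  - by move=> j /=; rewrite geometric_ge0// ?mulr_ge0 ?invr_ge0// ltW.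
  - move=> j /=.
    have xi : 0 < `|x i| by rewrite normr_gt0 basis_neq0.
    have -> : 2 * C * `|v| / `|x i| * 2^-1 ^+ j =
              2 * (C * (`|v| * 2^-1 ^+ j)) / `|x i| by lra.
    rewrite ler_pdivlMr// -normrZ.
    have -> : coef x (g (r j)) i *: x i =
              psum x i.+1 (g (r j)) - psum x i (g (r j)).
      by rewrite psumS addrC addKr.
    have := ler_normB (psum x i.+1 (g (r j))) (psum x i (g (r j))).
    by have := gle j i.+1; have := gle j i; lra.
  - by apply: is_cvg_geometric_series; rewrite gtr0_norm ?invr_gt0//; lra.
pose a i : R := lim (series (c i) @ \oo).
pose A n := \sum_(0 <= i < n) a i *: x i.
have cvgP n : (fun J => psum x n (S J)) @ \oo --> A n.
  elim: n => [|n ih].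
    have -> : (fun J => psum x 0 (S J)) = (fun=> A 0%N).
      by apply/funext => J; rewrite /psum /A !big_nil.
    exact: cvg_cst.
  have -> : (fun J => psum x n.+1 (S J)) =
            (fun J => psum x n (S J) + series (c n) J *: x n).
    apply/funext => J; rewrite psumS; congr (_ + _ *: _).
    by rewrite /S coef_bigsum.
  rewrite /A big_nat_recr//=; apply: cvgD; first exact: ih.
  by apply: cvgZr_tmp; exact: cvgc.
(* 2^-1 ^+ j = 2 * (2^-1 ^+ j - 2^-1 ^+ j.+1) makes the bounds telescope *)
have tail n J d : `|psum x n (S (J + d)%N) - psum x n (S J)| <=
    2 * C * `|v| * (2^-1 ^+ J - 2^-1 ^+ (J + d)).
  elim: d => [|d ih]; first by rewrite addn0 !subrr normr0 mulr0.
  rewrite addnS {1}/S big_nat_recr//= -/(S _) psumD addrAC.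
  have := ler_normD (psum x n (S (J + d)%N) - psum x n (S J))
    (psum x n (g (r (J + d)%N))).
  have := gle (J + d)%N n; rewrite exprSr; lra.
have tailA n J : `|A n - psum x n (S J)| <= 2 * C * `|v| * 2^-1 ^+ J.
  apply: (cvg_dist_le (N := J) (cvgP n)) => m /subnKC <-.
  apply: le_trans (tail n J _) _.
  rewrite ler_wpM2l//; first by rewrite !mulr_ge0// ltW.
  by rewrite gerBl exprn_ge0// invr_ge0.
have Av : A @ \oo --> v.
  apply/cvg_seqP => e e0.
  have [J hJ] : exists J, (2 * C * `|v| + `|v|) * 2^-1 ^+ J < e / 2.
    have : geometric (2 * C * `|v| + `|v|) (2^-1 : R) @ \oo --> (0 : R).
      by apply: cvg_geometric; rewrite gtr0_norm ?invr_gt0//; lra.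
    have e20 : 0 < e / 2 by lra.
    move=> /cvg_seqP/(_ _ e20)[J /(_ J (leqnn J))].
    rewrite sub0r normrN /= ger0_norm => [h|]; first by exists J.
    by rewrite mulr_ge0 ?exprn_ge0// ?invr_ge0// addr_ge0// !mulr_ge0// ltW.
  have e20 : 0 < e / 2 by lra.
  have [N hN] := (@cvg_seqP _ _ _ _).1 (@psum_cvg (S J)) _ e20.
  exists N => n /hN hn.
  have := tailA n J; rewrite distrC => hA.
  have := rle J; rewrite -SE => hS.
  have := ler_normD (v - S J) (S J - psum x n (S J)).
  have := ler_normD (v - S J + (S J - psum x n (S J))) (psum x n (S J) - A n).
  rewrite !addrA !subrK; lra.
rewrite /psum (coef_unique Av) -/(A n0).
have := tailA n0 0%N.
by rewrite /S big_nil psum0 subr0 expr0 mulr1.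
Qed.

End Basis.

(** * Finitely supported vectors and block sequences *)

(** The span of the [x i], [m <= i], described by coefficients. *)
Definition ftail (R : realType) (X : normedModType R) (x : nat -> X)
    (m : nat) : set X :=
  [set v | (forall i, (i < m)%N -> coef x v i = 0) /\
           exists N, forall i, (N <= i)%N -> coef x v i = 0].

(** The unit vectors of [ftail x m]. *)
Definition fsphere (R : realType) (X : normedModType R) (x : nat -> X)
    (m : nat) : set X :=
  [set v | ftail x m v /\ `|v| = 1].

(** A bound of the support of a finitely supported vector: its coefficients
    vanish from this index on. *)
Definition supp_end (R : realType) (X : normedModType R) (x : nat -> X)
    (v : X) : nat :=
  xget 0%N [set N | forall i, (N <= i)%N -> coef x v i = 0].

Section Blocks.
Context (R : realType) (X : completeNormedModType R) (x : nat -> X).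
Hypothesis hx : schauder_basis x.
Implicit Types (u v w : X) (a b : nat -> R) (m n i j : nat).

Lemma big_nat_eq0 (V : nmodType) m n (F : nat -> V) :
  (forall i, (m <= i)%N -> (i < n)%N -> F i = 0) ->
  \sum_(m <= i < n) F i = 0.
Proof.
move=> h; rewrite big_nat_cond big1// => i /andP[/andP[mi iN] _].
exact: h.
Qed.

Lemma ftail_linear m (c : R) u v :
  ftail x m u -> ftail x m v -> ftail x m (c *: u + v).
Proof.
move=> [u0 [M hM]] [v0 [N hN]]; split=> [i im|].
  by rewrite coef_linear// u0// v0// mulr0 addr0.
exists (maxn M N) => i; rewrite geq_max => /andP[Mi Ni].
by rewrite coef_linear// hM// hN// mulr0 addr0.
Qed.

Lemma ftail0 m : ftail x m 0.
Proof. by split=> [i _|]; [|exists 0%N => i _]; rewrite coef_zero. Qed.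

Lemma ftailZ m (c : R) u : ftail x m u -> ftail x m (c *: u).
Proof. by move=> /(ftail_linear c)/(_ (ftail0 m)); rewrite addr0. Qed.

Lemma ftailD m u v : ftail x m u -> ftail x m v -> ftail x m (u + v).
Proof. by rewrite -{2}[u]scale1r; exact: ftail_linear. Qed.

Lemma ftailW m n v : (m <= n)%N -> ftail x n v -> ftail x m v.
Proof. by move=> mn [h0 h1]; split=> // i im; apply: h0; exact: leq_trans mn. Qed.

Lemma fsphereW m n v : (m <= n)%N -> fsphere x n v -> fsphere x m v.
Proof. by move=> mn [h0 h1]; split=> //; exact: ftailW h0. Qed.

Lemma fsphere_neq0 m v : fsphere x m v -> v != 0.
Proof. by move=> [_ v1]; rewrite -normr_eq0 v1 oner_eq0. Qed.

Lemma ftail_normalize m v : ftail x m v -> v != 0 -> fsphere x m (`|v|^-1 *: v).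
Proof. by move=> h v0; split; [exact: ftailZ|rewrite normfZV]. Qed.

Lemma finite_expansion_coef a v : finite_expansion x a v -> coef x v = a.
Proof.
move=> [N [hN ->]]; apply: coef_unique => //; apply/cvg_seqP => e e0.
exists N => n Nn; rewrite (big_cat_nat (n := N) (p := n))//=.
rewrite (@big_nat_eq0 _ N n) ?addr0 ?subrr ?normr0// => i Ni _.
by rewrite hN// scale0r.
Qed.

Lemma coef_finite_expansion v :
  ftail x 0 v -> finite_expansion x (coef x v) v.
Proof.
move=> [_ [N hN]]; exists N; split=> //.
apply/esym/eqP; rewrite -subr_eq0 -normr_eq0; apply/eqP/le_anti.
rewrite normr_ge0 andbT distrC.
apply/ler_addgt0Pr => e e0; rewrite add0r.
have [M hM] := (cvg_seqP _ _).1 (psum_cvg hx (v := v)) e e0.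
have := hM (maxn M N) (leq_maxl _ _).
rewrite /psum (big_cat_nat (n := N) (p := maxn M N))//= ?leq_maxr//.
rewrite (@big_nat_eq0 _ N) ?addr0; first by move/ltW.
by move=> i Ni _; rewrite hN// scale0r.
Qed.

Lemma finite_expansion_ftail a v : finite_expansion x a v -> ftail x 0 v.
Proof.
move=> h; split=> //; case: (h) => N [hN _]; exists N.
by rewrite (finite_expansion_coef h).
Qed.

Lemma supp_endP m v i : ftail x m v -> (supp_end x v <= i)%N -> coef x v i = 0.
Proof.
move=> [_ [N hN]].
exact: (@xgetPex _ 0%N [set N | forall i, (N <= i)%N -> coef x v i = 0]
  (ex_intro _ N hN)).
Qed.

Lemma ftail_psum_supp m v : ftail x m v -> psum x (supp_end x v) v = v.
Proof.
move=> hv; have [N [hN {3}->]] := coef_finite_expansion (ftailW (leq0n m) hv).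
have cut k M : (k <= M)%N -> (forall i, (k <= i)%N -> coef x v i = 0) ->
    \sum_(0 <= i < M) coef x v i *: x i = \sum_(0 <= i < k) coef x v i *: x i.
  move=> kM hk; rewrite (big_cat_nat (n := k))//= (@big_nat_eq0 _ k) ?addr0//.
  by move=> i ki _; rewrite hk// scale0r.
rewrite /psum -(cut (supp_end x v) (maxn (supp_end x v) N)) ?leq_maxl//; last first.
  by move=> i; exact: (supp_endP hv).
by rewrite (cut N) ?leq_maxr.
Qed.

Lemma psum_ftail m v : ftail x m v -> psum x m v = 0.
Proof.
move=> [h0 _]; rewrite /psum big_nat_eq0// => i _ im.
by rewrite h0// scale0r.
Qed.

Lemma coef_basis j : coef x (x j) = (fun i => (i == j)%:R).
Proof.
apply: finite_expansion_coef; exists j.+1; split.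
  by move=> i mi; rewrite gtn_eqF.
rewrite big_nat_recr//= eqxx scale1r big_nat_eq0 ?add0r//.
by move=> i _ im; rewrite ltn_eqF// scale0r.
Qed.

Lemma fsphere_nonempty m : exists v, fsphere x m v.
Proof.
exists (`|x m|^-1 *: x m); apply: ftail_normalize; last exact: basis_neq0.
split=> [i im|]; first by rewrite coef_basis ltn_eqF.
by exists m.+1 => i mi; rewrite coef_basis gtn_eqF.
Qed.

Lemma successiveP u v : successive x u v <->
  [/\ ftail x 0 u, ftail x 0 v &
    forall i j, coef x u i != 0 -> coef x v j != 0 -> (i < j)%N].
Proof.
split=> [[a [b [ha hb hab]]]|[hu hv huv]].
  split; [exact: finite_expansion_ftail ha|exact: finite_expansion_ftail hb|].
  by rewrite (finite_expansion_coef ha) (finite_expansion_coef hb).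
by exists (coef x u), (coef x v); split => //; exact: coef_finite_expansion.
Qed.

Lemma supp_end_successive m n u v :
  ftail x m u -> ftail x n v -> (supp_end x u <= n)%N -> successive x u v.
Proof.
move=> hu hv un; apply/successiveP; split.
- exact: ftailW hu.
- exact: ftailW hv.
move=> i j ui vj; apply: (@leq_trans n).
  apply: leq_trans un; rewrite ltnNge; apply: contra ui => /(supp_endP hu) ->.
  by rewrite eqxx.
by rewrite leqNgt; apply: contra vj => /(proj1 hv) ->; rewrite eqxx.
Qed.

Lemma coef_cvg (u : nat -> X) v i :
  u @ \oo --> v -> (fun n => coef x (u n) i) @ \oo --> coef x v i.
Proof.
have [K [K0 hK]] := psum_bounded hx.
move=> /cvg_seqP uv; apply/cvg_seqP => e e0.
have xi : 0 < `|x i| by rewrite normr_gt0 basis_neq0.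
have d0 : 0 < e * `|x i| / (2 * K + 1) by rewrite divr_gt0 ?mulr_gt0//; lra.
have [N hN] := uv _ d0; exists N => n /hN.
rewrite ltr_pdivlMr => [h|]; last by lra.
rewrite -coef_opp// -coef_add// -(ltr_pM2r xi) -normrZ.
set w := v - u n in h *.
have -> : coef x w i *: x i = psum x i.+1 w - psum x i w.
  by rewrite psumS addrC addKr.
have := ler_normB (psum x i.+1 w) (psum x i w).
have := hK i.+1 w; have := hK i w; have := normr_ge0 w; lra.
Qed.

Lemma seq_continuous_closure_eq0 (A : set X) (f : X -> R) v :
  (forall (u : nat -> X) w, u @ \oo --> w -> (fun n => f (u n)) @ \oo --> f w) ->
  (forall w, A w -> f w = 0) -> closure A v -> f v = 0.
Proof.
move=> fc fA vA.
have h n : exists w, A w /\ `|v - w| < n.+1%:R^-1.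
  have [|w [Aw hw]] := vA (ball v n.+1%:R^-1).
    by apply: nbhsx_ballx; rewrite invr_gt0.
  by exists w; rewrite -ball_normE in hw.
have [u hu] := choice h.
have uv : u @ \oo --> v.
  apply/cvg_seqP => e e0; exists (Num.truncn e^-1) => n en.
  apply: lt_trans (proj2 (hu n)) _.
  rewrite invf_plt ?posrE//; apply: lt_le_trans (truncnS_gt _) _.
  by rewrite ler_nat.
have := fc u v uv.
have -> : (fun n => f (u n)) = (fun=> 0) by apply/funext => n; exact/fA/(hu n).1.
by move=> /(@cvg_lim _ (@Rhausdorff R)) <-; exact: lim_cst.
Qed.

Lemma closed_span_coef m v i : closed_span x m v -> (i < m)%N -> coef x v i = 0.
Proof.
move=> hv im; apply: (seq_continuous_closure_eq0 (f := fun v => coef x v i) _ _ hv).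
  by move=> u w; exact: coef_cvg.
move=> _ [N [a ->]]; rewrite coef_bigsum// big_nat_eq0// => j mj _; rewrite coef_scale//.
by rewrite coef_basis ltn_eqF ?mulr0//; exact: leq_trans mj.
Qed.

Lemma ftail_closed_span m v : ftail x m v -> closed_span x m v.
Proof.
move=> hv; apply: subset_closure.
have [N [hN hvN]] := coef_finite_expansion (ftailW (leq0n m) hv).
exists N, (coef x v); rewrite {1}hvN.
have [Nm|mN] := leqP N m.
  rewrite (@big_geq _ _ _ m N)// big_nat_eq0// => i _ iN.
  by rewrite (proj1 hv) ?scale0r//; exact: leq_trans Nm.
rewrite (big_cat_nat (n := m))//=; last exact: ltnW.
rewrite (@big_nat_eq0 _ 0 m) ?add0r// => i _ im.
by rewrite (proj1 hv) ?scale0r.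
Qed.

(** Two successive unit vectors are uniformly linearly independent. *)
Lemma successive_lower_bound : exists c : R, 0 < c /\
  forall m y w, fsphere x m y -> fsphere x (supp_end x y) w ->
  forall a b : R, c * `|a| <= `|a *: y + b *: w| /\
                  c * `|b| <= `|a *: y + b *: w|.
Proof.
have [K [K0 hK]] := psum_bounded hx.
exists (K + 1)^-1; split=> [|m y w [hy y1] [hw w1] a b].
  by rewrite invr_gt0; lra.
have K1 : 0 < K + 1 by lra.
rewrite !ler_pdivrMl//; set z := a *: y + b *: w.
have ha : psum x (supp_end x y) z = a *: y.
  by rewrite psumD// !psumZ// (ftail_psum_supp hy) (psum_ftail hw) scaler0 addr0.
have : `|a| <= K * `|z|.
  by have := hK (supp_end x y) z; rewrite ha normrZ y1 mulr1.
have : `|b| <= (K + 1) * `|z|.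
  have -> : `|b| = `|b *: w| by rewrite normrZ w1 mulr1.
  have -> : b *: w = z - a *: y by rewrite /z addrC addKr.
  have := ler_normB z (a *: y).
  by have := hK (supp_end x y) z; rewrite ha; lra.
have := normr_ge0 z; lra.
Qed.

Lemma block_sequence_fsphere (z : nat -> X) :
  block_sequence x z -> (forall n, `|z n| = 1) -> forall n, fsphere x n (z n).
Proof.
move=> [zn zs] z1; elim=> [|n [ih _]]; split=> //.
  by have [_ [a ha]] := zn 0%N; exact: finite_expansion_ftail ha.
have /successiveP[h0 h1 h] := zs n; split=> [j jn|]; last exact: (proj2 h1).
have [i ni] : exists i, coef x (z n) i != 0.
  apply: contrapT => hno; have [+ _] := zn n; apply/negP; rewrite negbK.
  rewrite -(ftail_psum_supp ih) /psum big1// => i _.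
  apply/eqP; rewrite scaler_eq0; apply/orP; left; apply: contrapT => hi.
  by apply: hno; exists i; apply/negP.
apply/eqP; apply: contrapT => /negP nj.
have ij := h _ _ ni nj.
have : (n <= i)%N.
  by rewrite leqNgt; apply: contra ni => /(proj1 ih) ->.
lia.
Qed.

(** Iterating a choice of vectors arbitrarily far out yields a block
    sequence. *)
Lemma block_sequence_of_choice (s : nat -> X) M :
  (forall m, fsphere x m (s m)) ->
  exists z, [/\ block_sequence x z, forall n, `|z n| = 1 &
                forall n, exists2 m, (M <= m)%N & z n = s m].
Proof.
move=> hs.
pose z := fix z n := match n with
  | 0%N => s M | n'.+1 => s (maxn M (supp_end x (z n'))) end.
have hz n : exists2 m, (M <= m)%N & z n = s m.
  by case: n => [|n]; [exists M|exists (maxn M (supp_end x (z n))); rewrite ?leq_maxl].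
have hz1 n : fsphere x M (z n).
  by have [m Mm ->] := hz n; exact: fsphereW (hs m).
exists z; split=> //; last by move=> n; exact: (proj2 (hz1 n)).
split=> n.
  split; first exact: fsphere_neq0 (hz1 n).
  exists (coef x (z n)); apply: coef_finite_expansion.
  by have [h _] := hz1 n; exact: ftailW h.
apply: (@supp_end_successive M (maxn M (supp_end x (z n)))).
- by have [] := hz1 n.
- by have [] := hs (maxn M (supp_end x (z n))).
- exact: leq_maxr.
Qed.

(** A sequence of unit vectors, each beyond the supports of the previous ones,
    is basic: the expansion of a vector of its closed span is obtained by
    cutting the expansion with respect to [x] into blocks. *)
Lemma far_sequence_basic (y : nat -> X) :
  (forall n, fsphere x 0 (y n)) ->
  (forall i j, (i < j)%N -> fsphere x (supp_end x (y i)) (y j)) ->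
  basic_sequence y.
Proof.
move=> y1 yfar.
pose p n := if n is n'.+1 then supp_end x (y n') else 0%N.
have yp n : fsphere x (p n) (y n) by case: n => [|n]; [exact: y1|exact: yfar].
(* The coefficient of y n in a vector is read off at an index o n of the
   support of y n, which lies in the interval [p n, p n.+1). *)
have nz n : {i | coef x (y n) i != 0}.
  apply: cid; apply: contrapT => hno.
  have /negP := fsphere_neq0 (y1 n); apply.
  rewrite -(ftail_psum_supp (proj1 (y1 n))) /psum big1// => i _.
  apply/eqP; rewrite scaler_eq0; apply/orP; left; apply: contrapT => hi.
  by apply: hno; exists i; apply/negP.
pose o n := sval (nz n).
have oP n : coef x (y n) (o n) != 0 by exact: svalP (nz n).
have po n : (p n <= o n)%N.
  by rewrite leqNgt; apply: contra (oP n) => /(proj1 (proj1 (yp n))) ->.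
have op n : (o n < p n.+1)%N.
  rewrite ltnNge; apply: contra (oP n) => h.
  by rewrite (supp_endP (proj1 (y1 n)) h).
have pS n : (p n < p n.+1)%N by exact: leq_ltn_trans (op n).
have pmono m n : (m <= n)%N -> (p m <= p n)%N.
  elim: n => [|n ih]; first by rewrite leqn0 => /eqP ->.
  rewrite leq_eqVlt => /predU1P[->//|]; rewrite ltnS => /ih h.
  by apply: leq_trans h _; exact: ltnW.
have disj i j k : (p j <= k)%N -> (k < p j.+1)%N -> i != j -> coef x (y i) k = 0.
  move=> jk kj; rewrite neq_ltn => /orP[ij|ji].
    apply: (supp_endP (proj1 (y1 i))); apply: leq_trans jk.
    exact: (pmono i.+1 j).
  apply: (proj1 (proj1 (yp i))); apply: leq_trans kj _.
  exact: (pmono j.+1 i).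
have coefy (b : nat -> R) n j k : (p j <= k)%N -> (k < p j.+1)%N ->
    coef x (\sum_(0 <= i < n) b i *: y i) k =
    if (j < n)%N then b j * coef x (y j) k else 0.
  move=> jk kj; rewrite coef_bigsum//.
  under eq_bigr do rewrite coef_scale//.
  case: ifP => jn.
    rewrite (bigD1_seq j) ?mem_index_iota ?iota_uniq//= big1 ?addr0//.
    by move=> i ij; rewrite (disj _ j)// mulr0.
  rewrite big_nat_eq0// => i _ iN.
  rewrite (disj _ j) ?mulr0//; apply/eqP => ij.
  by rewrite -ij iN in jn.
(* on the n-th interval, the vectors of the closed span are multiples of y n *)
have key v : closed_span y 0 v -> forall j k, (p j <= k)%N -> (k < p j.+1)%N ->
    coef x v k = coef x v (o j) / coef x (y j) (o j) * coef x (y j) k.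
  move=> hv j k jk kj; apply/eqP; rewrite -subr_eq0; apply/eqP.
  apply: (seq_continuous_closure_eq0 (f := fun v => coef x v k -
    coef x v (o j) / coef x (y j) (o j) * coef x (y j) k) _ _ hv).
    move=> u w uw; apply: cvgB; first exact: coef_cvg.
    by apply: cvgMr_tmp; apply: cvgMr_tmp; exact: coef_cvg.
  move=> _ [N [a ->]]; rewrite !(@coefy a N j)//.
  case: ifP => _; last by rewrite !mul0r subrr.
  by rewrite mulfK// subrr.
split=> [i|v hv].
  apply: subset_closure; exists i.+1, (fun k => (k == i)%:R).
  rewrite big_nat_recr//= eqxx scale1r big_nat_eq0 ?add0r//.
  by move=> k _ km; rewrite ltn_eqF// scale0r.
pose b j := coef x v (o j) / coef x (y j) (o j).
exists b; split.
  have E n : \sum_(0 <= i < n) b i *: y i = psum x (p n) v.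
    elim: n => [|n ih]; first by rewrite /psum !big_nil.
    rewrite big_nat_recr//= ih /psum (big_cat_nat (n := p n) (p := p n.+1))//=;
      last exact: ltnW.
    congr (_ + _).
    have yE : y n = \sum_(p n <= i < p n.+1) coef x (y n) i *: x i.
      rewrite -{1}(ftail_psum_supp (proj1 (y1 n))) -/(p n.+1) /psum.
      rewrite (big_cat_nat (n := p n))//=; last exact: ltnW.
      by rewrite -/(psum x (p n) (y n)) (psum_ftail (proj1 (yp n))) add0r.
    apply: (etrans (congr1 (fun z => b n *: z) yE)).
    rewrite scaler_sumr; apply: eq_big_nat => k /andP[k1 k2].
    by rewrite scalerA (key v hv n).
  rewrite [X in X @ _](_ : _ = (fun n => psum x n v) \o p); last first.
    by apply/funext => n; rewrite /series/= E.
  apply: (@cvg_comp _ _ _ p (fun n => psum x n v) \oo \oo (nbhs v));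
    last exact: psum_cvg.
  apply/cvgnyPge => M; exists M => // n /= Mn; apply: leq_trans Mn _.
  by elim: n => // n ih; exact: leq_ltn_trans ih (pS n).
move=> a hab; apply/funext => j.
have h := coef_cvg (i := o j) hab.
have : (fun n => coef x (series (fun i => a i *: y i) n) (o j)) @ \oo -->
    a j * coef x (y j) (o j).
  apply: cvg_near_cst; exists j.+1 => // n /= jn.
  by rewrite /series/= (@coefy a n j)// jn.
by move=> /(cvg_unique (@Rhausdorff R) h) ab; rewrite /b ab mulfK.
Qed.

End Blocks.

(** * Pairs of vectors close to a two-dimensional norm *)

(** The pair [(y, w)] is [c]-equivalent to the basis of [(R^2, N)]. *)
Definition okpair (R : realType) (X : normedModType R) (c : R)
    (N : R -> R -> R) (y w : X) : Prop :=
  forall a b, c^-1 * N a b <= `|a *: y + b *: w| <= c * N a b.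

(** Up to any [eps], every pair of successive unit vectors chosen far enough
    out, the second one far beyond the first, spans [(R^2, N)]. *)
Definition asymptotic_pair (R : realType) (X : normedModType R) (x : nat -> X)
    (N : R -> R -> R) : Prop :=
  forall eps : R, 0 < eps -> exists m, forall y, fsphere x m y ->
    exists m', forall w, fsphere x m' w -> okpair (1 + eps) N y w.

(** In this section, the norms of the combinations of the pairs [(y t, w t)]
    converge pointwise to [N] along [F]. *)
Section PairLimit.
Context (R : realType) (X : normedModType R) (T : Type) (F : set_system T).
Context {FF : ProperFilter F}.
Context (y w : T -> X) (N : R -> R -> R) (c : R).
Hypothesis c0 : 0 < c.
Hypothesis hyw : \forall t \near F, [/\ `|y t| = 1, `|w t| = 1 &
  forall a b : R, c * `|a| <= `|a *: y t + b *: w t| /\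
                  c * `|b| <= `|a *: y t + b *: w t|].
Hypothesis hN : forall a b, `|a *: y t + b *: w t| @[t --> F] --> N a b.

Lemma pair_limit_near a b (e : R) : 0 < e ->
  \forall t \near F, `|N a b - `|a *: y t + b *: w t| | < e.
Proof. by move=> e0; have /cvgrPdist_lt/(_ e e0) := @hN a b. Qed.

Lemma pair_limitZ s a b : N (s * a) (s * b) = `|s| * N a b.
Proof.
have h := @hN (s * a) (s * b).
have h' : `|s| * `|a *: y t + b *: w t| @[t --> F] --> `|s| * N a b.
  by apply: cvgMl_tmp; exact: hN.
apply: (cvg_unique (@Rhausdorff R) h).
apply: cvg_trans h'; apply: near_eq_cvg; near=> t.
by rewrite -normrZ scalerDr !scalerA.
Unshelve. all: by end_near. Qed.

Lemma pair_limit_triangle a b a' b' : N (a + a') (b + b') <= N a b + N a' b'.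
Proof.
apply/ler_addgt0Pr => e e0; have e3 : 0 < e / 3 by rewrite divr_gt0.
near F => t.
have h1 : `|N a b - `|a *: y t + b *: w t| | < e / 3.
  by near: t; exact: pair_limit_near.
have h2 : `|N a' b' - `|a' *: y t + b' *: w t| | < e / 3.
  by near: t; exact: pair_limit_near.
have h3 : `|N (a + a') (b + b') - `|(a + a') *: y t + (b + b') *: w t| | < e / 3.
  by near: t; exact: pair_limit_near.
have := ler_normD (a *: y t + b *: w t) (a' *: y t + b' *: w t).
rewrite addrACA -!scalerDl.
move: h1 h2 h3; rewrite !ltr_norml => /andP[+ _] /andP[+ _] /andP[_ +]; lra.
Unshelve. all: by end_near. Qed.

Lemma pair_limit_ge a b : c * `|a| <= N a b /\ c * `|b| <= N a b.
Proof.
split; apply/ler_addgt0Pr => e e0; near F => t;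
  have /ltr_normlP[h0 h1] : `|N a b - `|a *: y t + b *: w t| | < e
    by [near: t; exact: pair_limit_near];
  have [_ _ /(_ a b)] : [/\ `|y t| = 1, `|w t| = 1 &
    forall a b : R, c * `|a| <= `|a *: y t + b *: w t| /\
                  c * `|b| <= `|a *: y t + b *: w t|] by [near: t];
  lra.
Unshelve. all: by end_near. Qed.

Lemma pair_limit_le a b : N a b <= `|a| + `|b|.
Proof.
apply/ler_addgt0Pr => e e0; near F => t.
have /ltr_normlP[h0 h1] : `|N a b - `|a *: y t + b *: w t| | < e.
  by near: t; exact: pair_limit_near.
have [y1 w1 _] : [/\ `|y t| = 1, `|w t| = 1 &
    forall a b : R, c * `|a| <= `|a *: y t + b *: w t| /\
                  c * `|b| <= `|a *: y t + b *: w t|] by near: t.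
have := ler_normD (a *: y t) (b *: w t); rewrite !normrZ y1 w1; lra.
Unshelve. all: by end_near. Qed.

Lemma pair_limit_lip a b a' b' : N a b <= N a' b' + (`|a - a'| + `|b - b'|).
Proof.
have := pair_limit_triangle a' b' (a - a') (b - b').
rewrite ![_ + (_ - _)]addrC !subrK.
have := pair_limit_le (a - a') (b - b'); lra.
Qed.

(** Pointwise convergence of the norms on the plane is uniform, by
    approximation on a finite grid. *)
Lemma pair_limit_uniform (eps : R) : 0 < eps ->
  \forall t \near F, okpair (1 + eps) N (y t) (w t).
Proof.
move=> e0; have ce : 0 < c * eps by rewrite mulr_gt0.
pose M := (Num.truncn (8 / (c * eps))).+1.
have M0 : 0 < M%:R :> R by rewrite ltr0n.
have hM : 4 / M%:R < c * eps / 2.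
  have : 8 / (c * eps) < M%:R by exact: truncnS_gt.
  by rewrite !ltr_pdivrMr//; lra.
(* the grid of mesh 1 / M in [-1, 1] *)
pose g (i : 'I_(2 * M).+1) : R := (i%:R - M%:R) / M%:R.
have grid a : `|a| <= 1 -> exists i, `|a - g i| <= M%:R^-1.
  move=> a1; have [al ar] : -1 <= a /\ a <= 1 by move: a1; rewrite ler_norml => /andP.
  have h0 : 0 <= (a + 1) * M%:R by rewrite mulr_ge0//; lra.
  have /andP[i1 i2] := truncn_itv h0.
  set i := Num.truncn _ in i1 i2.
  have iM : (i < (2 * M).+1)%N.
    rewrite ltnS -(ler_nat R) natrM; apply: le_trans i1 _.
    by rewrite ler_pM2r//; lra.
  exists (Ordinal iM); rewrite /g /=.
  have -> : a - (i%:R - M%:R) / M%:R = ((a + 1) * M%:R - i%:R) / M%:R.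
    by field; rewrite gt_eqF.
  rewrite normrM normfV (gtr0_norm M0) -[leRHS]mul1r ler_pM2r ?invr_gt0//.
  by rewrite -natr1 in i2; rewrite ler_norml; lra.
near=> t.
have [y1 w1 low] : [/\ `|y t| = 1, `|w t| = 1 &
    forall a b : R, c * `|a| <= `|a *: y t + b *: w t| /\
                  c * `|b| <= `|a *: y t + b *: w t|] by near: t.
have hg (ij : 'I_(2 * M).+1 * 'I_(2 * M).+1) :
    `|N (g ij.1) (g ij.2) - `|g ij.1 *: y t + g ij.2 *: w t| | < c * eps / 2.
  move: ij; near: t; apply: filter_forall => ij.
  by apply: pair_limit_near; rewrite divr_gt0.
have unif a b : `|a| <= 1 -> `|b| <= 1 ->
    N a b <= `|a *: y t + b *: w t| + c * eps /\
    `|a *: y t + b *: w t| <= N a b + c * eps.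
  move=> /grid[i hi] /grid[j hj].
  have := hg (i, j); rewrite /= ltr_norml => /andP[h1 h2].
  have h3 := pair_limit_lip a b (g i) (g j).
  have h4 := pair_limit_lip (g i) (g j) a b.
  have lip a1 b1 a2 b2 : `|a1 *: y t + b1 *: w t| <=
      `|a2 *: y t + b2 *: w t| + (`|a1 - a2| + `|b1 - b2|).
    have := ler_normD (a2 *: y t + b2 *: w t)
      ((a1 - a2) *: y t + (b1 - b2) *: w t).
    have := ler_normD ((a1 - a2) *: y t) ((b1 - b2) *: w t).
    rewrite addrACA -!scalerDl ![_ + (_ - _)]addrC !subrK !normrZ y1 w1; lra.
  have h5 := lip a b (g i) (g j).
  have h6 := lip (g i) (g j) a b.
  rewrite (distrC (g i)) (distrC (g j)) in h4 h6.
  by split; lra.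
move=> a b.
(* by homogeneity, it suffices to treat the case max |a| |b| = 1 *)
pose s := Num.max `|a| `|b|.
have sa : `|a| <= s by rewrite le_max lexx.
have sb : `|b| <= s by rewrite le_max lexx orbT.
have [s0|s0] := leP s 0.
  have a0 : a = 0 by apply/eqP; rewrite -normr_le0; exact: le_trans s0.
  have b0 : b = 0 by apply/eqP; rewrite -normr_le0; exact: le_trans s0.
  have -> : N a b = 0.
    by have := pair_limitZ 0 a b; rewrite a0 b0 !mul0r normr0 mul0r.
  by rewrite a0 b0 !scale0r addr0 normr0 !mulr0 lexx.
have ea : a = s * (a / s) by rewrite mulrCA mulfV ?mulr1// gt_eqF.
have eb : b = s * (b / s) by rewrite mulrCA mulfV ?mulr1// gt_eqF.
have na : `|a / s| <= 1 by rewrite normrM normfV (gtr0_norm s0) ler_pdivrMr// mul1r.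
have nb : `|b / s| <= 1 by rewrite normrM normfV (gtr0_norm s0) ler_pdivrMr// mul1r.
have [h1 h2] := unif _ _ na nb.
have eN : N a b = s * N (a / s) (b / s) by rewrite {1}ea {1}eb pair_limitZ gtr0_norm.
have ef : `|a *: y t + b *: w t| = s * `|(a / s) *: y t + (b / s) *: w t|.
  by rewrite {1}ea {1}eb -!scalerA -scalerDr normrZ gtr0_norm.
have [l1 l2] := low (a / s) (b / s).
have [n1 n2] := pair_limit_ge (a / s) (b / s).
have hs : `|a / s| = 1 \/ `|b / s| = 1.
  rewrite !normrM !normfV (gtr0_norm s0).
  have : s = `|a| \/ s = `|b| by rewrite /s; case: ltP; [right|left].
  by case=> <-; [left|right]; rewrite mulfV// gt_eqF.
have cl : c <= `|(a / s) *: y t + (b / s) *: w t| by case: hs => hs; rewrite hs mulr1 in l1 l2 *.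
have cn : c <= N (a / s) (b / s) by case: hs => hs; rewrite hs mulr1 in n1 n2 *.
rewrite eN ef; set f := `|_ + _| in h1 h2 cl *; set n := N _ _ in h1 h2 cn *.
apply/andP; split.
  rewrite ler_pdivrMl; last by lra.
  have : c * eps <= f * eps by rewrite ler_pM2r.
  by move=> h; rewrite mulrCA ler_pM2l//; lra.
have : c * eps <= n * eps by rewrite ler_pM2r.
by move=> h; rewrite mulrCA ler_pM2l//; lra.
Unshelve. all: by end_near. Qed.

End PairLimit.

(** * The two-dimensional l_p norm *)

(** [lp_norm p 2] as a function of two real variables. *)
Definition lp2 (R : realType) (p : \bar R) (a b : R) : R :=
  match p with
  | r%:E => (`|a| `^ r + `|b| `^ r) `^ r^-1
  | +oo%E => Num.max `|a| `|b|
  | -oo%E => 0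
  end.

Lemma lp_exponent_ind (R : realType) (P : \bar R -> Prop) :
  (forall r : R, 1 <= r -> P r%:E) -> P +oo%E ->
  forall p, (1%:E <= p)%E -> P p.
Proof. by move=> Pr Py [r| |]//; rewrite lee_fin; exact: Pr. Qed.

Section Lp2.
Context (R : realType) (p : \bar R).
Hypothesis p1 : (1%:E <= p)%E.
Implicit Types a b c : R.

Lemma lp2_ge0 a b : 0 <= lp2 p a b.
Proof.
move: p p1; apply: lp_exponent_ind => [r _|]; first exact: powR_ge0.
by rewrite /= le_max normr_ge0.
Qed.

Lemma lp2Z c a b : lp2 p (c * a) (c * b) = `|c| * lp2 p a b.
Proof.
move: p p1; apply: lp_exponent_ind => [r r1|]; last by rewrite /= !normrM maxr_pMr.
rewrite /= !normrM !powRM// -mulrDr powRM//.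
by rewrite -powRrM mulfV ?powRr1// gt_eqF//; lra.
Qed.

Lemma lp2_normr a b : lp2 p a `|b| = lp2 p a b.
Proof. by rewrite /lp2 normr_id. Qed.

Lemma lp2_a0 a : lp2 p a 0 = `|a|.
Proof.
move: p p1; apply: lp_exponent_ind => [r r1|]; last by rewrite /= normr0 max_l.
rewrite /=; have r0 : r != 0 by rewrite gt_eqF//; lra.
by rewrite normr0 powR0// addr0 -powRrM mulfV// powRr1.
Qed.

Lemma lp2_le a b c : `|b| <= `|c| -> lp2 p a b <= lp2 p a c.
Proof.
move=> bc; move: p p1; apply: lp_exponent_ind => [r r1|].
  have r0 : 0 <= r by lra.
  apply: ge0_ler_powR; rewrite ?nnegrE ?addr_ge0 ?powR_ge0 ?invr_ge0//.
  by rewrite lerD2l ge0_ler_powR ?nnegrE.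
by rewrite /= ge_max !le_max lexx/= bc orbT.
Qed.

Lemma lp2_scale_le a b c : 1 <= c -> lp2 p a (c * b) <= c * lp2 p a b.
Proof.
move=> c1; have c0 : 0 <= c by lra.
have <- : lp2 p (c * a) (c * b) = c * lp2 p a b by rewrite lp2Z ger0_norm.
have sym u v : lp2 p u v = lp2 p v u.
  move: p p1; apply: lp_exponent_ind => [r _|]; rewrite /=; first by rewrite addrC.
  exact: maxC.
rewrite [leLHS]sym [leRHS]sym; apply: lp2_le.
by rewrite normrM ler_peMl// ger0_norm.
Qed.

Lemma lp_norm_rec n (a : 'I_n.+1 -> R) :
  lp_norm p a = lp2 p (a ord0) (lp_norm p (fun i => a (lift ord0 i))).
Proof.
move: p p1; apply: lp_exponent_ind => [r r1|]; rewrite /=.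
  have r0 : r != 0 by rewrite gt_eqF//; lra.
  rewrite big_ord_recl (ger0_norm (powR_ge0 _ _)) -powRrM mulVf// powRr1//.
  by rewrite sumr_ge0// => i _; exact: powR_ge0.
rewrite big_ord_recl; congr Num.max; rewrite ger0_norm//.
by elim/big_ind: _ => // u v u0 v0; rewrite le_max u0.
Qed.

Lemma lp_norm_nil (a : 'I_0 -> R) : lp_norm p a = 0.
Proof.
move: p p1; apply: lp_exponent_ind => [r r1|]; rewrite /= big_ord0//.
by rewrite powR0// invr_eq0 gt_eqF//; lra.
Qed.

Lemma lp_norm_ge0 n (a : 'I_n -> R) : 0 <= lp_norm p a.
Proof. by case: n a => [|n] a; rewrite ?lp_norm_nil ?lp_norm_rec ?lp2_ge0. Qed.

Lemma lp_norm2 (a : 'I_2 -> R) : lp_norm p a = lp2 p (a ord0) (a (lift ord0 ord0)).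
Proof. by rewrite !lp_norm_rec lp_norm_nil lp2_a0 lp2_normr. Qed.

End Lp2.

(** * Sequences chosen far out are close to the l_p basis *)

Section Chain.
Context (R : realType) (X : completeNormedModType R) (x : nat -> X).
Hypothesis hx : schauder_basis x.
Context (p : \bar R).
Hypothesis p1 : (1%:E <= p)%E.

(** A linear combination of the [u i] is split off from the front: first
    [u 0] against all the remaining vectors, then [u 1] against the rest, and
    so on.  The errors made are [t k / t k.+1], whose products telescope. *)
Lemma chain_equivalent (t : nat -> R) : (forall i, 1 <= t i) ->
  (forall i j, (i <= j)%N -> t j <= t i) ->
  forall n (u : 'I_n -> X) (k : 'I_n -> nat) (T : R),
  (forall i j : 'I_n, (i < j)%N -> (k i < k j)%N) ->
  (forall i, `|u i| = 1) ->
  (forall i, exists m,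
     (forall w, fsphere x m w -> okpair (t (k i) / t (k i).+1) (lp2 p) (u i) w) /\
     (forall j : 'I_n, (i < j)%N -> ftail x m (u j))) ->
  1 <= T -> (forall i, t (k i) <= T) -> equivalent_to_lpn T p u.
Proof.
move=> t1 tmon; have t0 i : 0 < t i by apply: lt_le_trans (t1 i).
elim=> [|n ih] u k T kmon u1 hu T1 kT a; rewrite /comb_norm.
  by rewrite big_ord0 lp_norm_nil// normr0 !mulr0 lexx.
rewrite big_ord_recl (lp_norm_rec p1).
set rest := \sum_(i < n) _; set L := lp_norm p _.
set s := t (k ord0).+1; set f := t (k ord0) / s.
have s1 : 1 <= s by exact: t1.
have s0 : 0 < s by exact: t0.
have f1 : 1 <= f by rewrite ler_pdivlMr// mul1r tmon.
have f0 : 0 < f by lra.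
have fs : f * s <= T by rewrite divfK ?gt_eqF//; exact: kT.
have /andP[r1 r2] : s^-1 * L <= `|rest| <= s * L.
  apply: (ih (fun i => u (lift ord0 i)) (fun i => k (lift ord0 i))) => //.
  - by move=> i j ij; apply: kmon; rewrite !lift0 ltnS.
  - move=> i; have [m [h1 h2]] := hu (lift ord0 i).
    by exists m; split=> // j ij; apply: h2; rewrite !lift0 ltnS.
  - by move=> i; apply: tmon; apply: kmon; rewrite lift0.
have [m [hm hm']] := hu ord0.
have trest : ftail x m rest.
  apply: (big_ind (ftail x m)); first exact: ftail0.
    by move=> v w; exact: ftailD.
  by move=> i _; apply: ftailZ => //; apply: hm'; rewrite lift0.
have /andP[q1 q2] : f^-1 * lp2 p (a ord0) `|rest| <=
    `|a ord0 *: u ord0 + rest| <= f * lp2 p (a ord0) `|rest|.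
  have [r0|r0] := eqVneq rest 0.
    rewrite r0 normr0 lp2_a0// addr0 normrZ u1 mulr1.
    by rewrite ler_pdivrMl// !ler_peMl.
  have := hm _ (ftail_normalize hx trest r0) (a ord0) `|rest|.
  by rewrite scalerA mulfV ?normr_eq0// scale1r.
have L0 : 0 <= L by exact: lp_norm_ge0.
have le1 : lp2 p (a ord0) `|rest| <= s * lp2 p (a ord0) L.
  apply: (le_trans (y := lp2 p (a ord0) (s * L))); last exact: lp2_scale_le.
  by apply: lp2_le => //; rewrite normr_id ger0_norm// mulr_ge0// ltW.
have le2 : lp2 p (a ord0) L <= s * lp2 p (a ord0) `|rest|.
  apply: (le_trans (y := lp2 p (a ord0) (s * `|rest|))); last exact: lp2_scale_le.
  apply: lp2_le => //; rewrite (ger0_norm L0) normrM normr_id (gtr0_norm s0).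
  by rewrite -ler_pdivrMl.
have T0 : 0 < T by lra.
apply/andP; split.
  rewrite ler_pdivrMl//.
  apply: le_trans le2 _; rewrite ler_pdivrMl in q1; last by [].
  apply: (le_trans (y := s * (f * `|a ord0 *: u ord0 + rest|))).
    by rewrite ler_pM2l.
  by rewrite mulrA ler_wpM2r// mulrC.
apply: (le_trans q2); apply: (le_trans (y := f * (s * lp2 p (a ord0) L))).
  by rewrite ler_pM2l.
by rewrite mulrA ler_wpM2r// lp2_ge0.
Qed.

(** A sequence decreasing from [1 + eps] to 1; the error allowed for the
    [i]-th vector is [tolerance eps i / tolerance eps i.+1]. *)
Definition tolerance (eps : R) (i : nat) : R := 1 + eps / i.+1%:R.

Lemma tolerance_ge1 eps i : 0 <= eps -> 1 <= tolerance eps i.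
Proof. by move=> e0; rewrite lerDl divr_ge0. Qed.

Lemma tolerance_decr eps i j : 0 <= eps -> (i <= j)%N -> tolerance eps j <= tolerance eps i.
Proof.
by move=> e0 ij; rewrite lerD2l ler_wpM2l// lef_pV2 ?posrE// ler_nat ltnS.
Qed.

Lemma tolerance_ratio eps i : 0 < eps -> 1 < tolerance eps i / tolerance eps i.+1.
Proof.
move=> e0; have e0' := ltW e0.
rewrite ltr_pdivlMr ?mul1r; last by apply: lt_le_trans (tolerance_ge1 _ e0').
by rewrite ltrD2l ltr_pM2l// ltf_pV2 ?posrE// ltr_nat.
Qed.

(** [M s] says how far out a vector has to be in order to continue the finite
    sequence [s]; along the resulting sequences, all finite subsequences are
    close to the l_p basis, the better the later they start. *)
Lemma far_requirement (eps : R) : 0 < eps -> asymptotic_pair x (lp2 p) ->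
  exists M : seq X -> nat, forall (n : nat) (u : nat -> X),
    (forall i, (i < n)%N -> fsphere x (M (mkseq u i)) (u i)) ->
    (forall i j, (i < j)%N -> (j < n)%N -> fsphere x (supp_end x (u i)) (u j)) /\
    forall l (k : 'I_l -> nat) (T : R),
      (forall i j : 'I_l, (i < j)%N -> (k i < k j)%N) ->
      (forall i, (k i < n)%N) -> 1 <= T -> (forall i, tolerance eps (k i) <= T) ->
      equivalent_to_lpn T p (u \o k).
Proof.
move=> e0 hp.
have ratio i : exists m, forall y, fsphere x m y -> exists m', forall w,
    fsphere x m' w -> okpair (tolerance eps i / tolerance eps i.+1) (lp2 p) y w.
  have := tolerance_ratio i e0; set q := _ / _ => q1.
  by have := hp (q - 1); rewrite subr_gt0 addrC subrK => /(_ q1).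
have [m hm] := choice ratio.
have ratio2 (iy : nat * X) : exists m', fsphere x (m iy.1) iy.2 ->
   forall w, fsphere x m' w ->
     okpair (tolerance eps iy.1 / tolerance eps iy.1.+1) (lp2 p) iy.2 w.
  have [/(hm iy.1)[m' h]|h] := pselect (fsphere x (m iy.1) iy.2).
    by exists m'.
  by exists 0%N.
have [m' hm'] := choice ratio2.
pose M (s : seq X) := maxn (m (size s))
  (\max_(j < size s) maxn (m' (nat_of_ord j, nth (0%R : X) s j))
     (supp_end x (nth (0%R : X) s j))).
exists M => n u hu.
have hu1 i : (i < n)%N -> fsphere x (m i) (u i).
  move=> /hu; apply: fsphereW; apply: leq_trans (leq_maxl _ _).
  by rewrite size_mkseq.
have hM i j : (i < j)%N -> (j < n)%N ->
    fsphere x (maxn (m' (i, u i)) (supp_end x (u i))) (u j).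
  move=> ij /hu; apply: fsphereW; apply: leq_trans (leq_maxr _ _).
  have ij' : (i < size (mkseq u j))%N by rewrite size_mkseq.
  have := @leq_bigmax _ (fun i : 'I_(size (mkseq u j)) =>
    maxn (m' (nat_of_ord i, nth (0%R : X) (mkseq u j) i))
      (supp_end x (nth (0%R : X) (mkseq u j) i)))
    (Ordinal ij').
  by rewrite /= nth_mkseq.
split=> [i j ij jn|l k T kmon kn T1 kT].
  by apply: fsphereW (hM i j ij jn); exact: leq_maxr.
have g1 i : 1 <= tolerance eps i by apply: tolerance_ge1; exact: ltW.
have gd i j : (i <= j)%N -> tolerance eps j <= tolerance eps i.
  by apply: tolerance_decr; exact: ltW.
apply: (chain_equivalent g1 gd (k := k)) => //.
- by move=> i /=; have [] := hu1 _ (kn i).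
move=> i; exists (m' (k i, u (k i))); split.
  by move=> w; apply: (hm' (k i, u (k i))); exact/hu1/kn.
move=> j ij /=; have [h _] := hM _ _ (kmon _ _ ij) (kn j).
by apply: ftailW h; exact: leq_maxl.
Qed.

End Chain.

Lemma history_recursion (A : Type) (g : seq A -> A) :
  exists k : nat -> A, forall i, k i = g (mkseq k i).
Proof.
pose h := fix h i := if i is i'.+1 then rcons (h i') (g (h i')) else [::].
exists (fun i => g (h i)) => i; congr g.
by elim: i => // i ih; rewrite mkseqS -ih.
Qed.

(** Almost isometric copies of l_p, or of c_0. *)
Lemma asymptotic_pair_copies (R : realType) (X : completeNormedModType R)
    (x : nat -> X) (hx : schauder_basis x) (p : \bar R) :
  (1%:E <= p)%E -> asymptotic_pair x (lp2 p) ->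
  forall eps : R, 0 < eps -> exists y : nat -> X, equivalent_to_lp (1 + eps) p y.
Proof.
move=> p1 hp eps e0; have [M hM] := far_requirement hx p1 e0 hp.
have [s hs] := choice (fsphere_nonempty hx).
have [y hy] := history_recursion (s \o M).
exists y => n.
have [|_ h] := hM n y; first by move=> i _; rewrite [y i]hy; exact: hs.
apply: (h n (fun i => i) (1 + eps)) => // [|i]; first by rewrite lerDl ltW.
by rewrite lerD2l ler_pdivrMr// ler_peMr ?ler1n// ltW.
Qed.

(** * The functional equation of the l_p norms *)

Lemma archimedean_eq (R : realType) (C u v : R) :
  (forall k : nat, k%:R * `|u - v| <= C) -> u = v.
Proof.
move=> h; apply/eqP; rewrite -subr_eq0 -normr_eq0; apply/negPn/negP => d0.
have {}d0 : 0 < `|u - v| by rewrite lt0r d0 /=.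
have := h (Num.truncn (C / `|u - v|)).+1.
by rewrite leNgt -ltr_pdivrMr// truncnS_gt.
Qed.

Lemma norm_fst_mono (R : realType) (N : R -> R -> R) :
  (forall s a b, N (s * a) (s * b) = `|s| * N a b) ->
  (forall a b a' b', N (a + a') (b + b') <= N a b + N a' b') ->
  (forall a b, N (- a) b = N a b) ->
  forall a a' b, `|a| <= `|a'| -> N a b <= N a' b.
Proof.
move=> NZ NT Ns a a' b; have [->|a'0] := eqVneq a' 0.
  by rewrite normr0 normr_le0 => /eqP ->.
have pa' : 0 < `|a'| by rewrite normr_gt0.
rewrite -[leRHS]mul1r -ler_pdivrMr// -normfV -normrM ler_norml => /andP[t1 t2].
set t := a / a' in t1 t2.
(* a is the convex combination of a' and - a' with weights (1 +- t) / 2 *)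
have -> : N a b = N ((1 + t) / 2 * a' + (1 - t) / 2 * (- a'))
                    ((1 + t) / 2 * b + (1 - t) / 2 * b).
  by congr N; rewrite /t; field.
apply: le_trans (NT _ _ _ _) _.
rewrite !NZ Ns !ger0_norm; lra.
Qed.

Section Bohnenblust.
Context (R : realType) (N : R -> R -> R).
Hypothesis NZ : forall s a b, N (s * a) (s * b) = `|s| * N a b.
Hypothesis NT : forall a b a' b', N (a + a') (b + b') <= N a b + N a' b'.
Hypothesis Na0 : forall a, N a 0 = `|a|.
Hypothesis N0b : forall b, N 0 b = `|b|.
Hypothesis Nsgn : forall a b, N (- a) b = N a b.
Hypothesis NA : forall a b c, N (N a b) c = N a (N b c).

Let mono1 a a' b : `|a| <= `|a'| -> N a b <= N a' b.
Proof. exact: norm_fst_mono. Qed.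

Let mono2 a b b' : `|b| <= `|b'| -> N a b <= N a b'.
Proof.
apply: (@norm_fst_mono R (fun u v => N v u)) => [s u v|u v u' v'|u v].
- exact: NZ.
- exact: NT.
by have := NZ (-1) v (- u); rewrite mulrNN !mul1r normrN1 mul1r mulN1r Nsgn.
Qed.

Let N_ge0 a b : 0 <= N a b.
Proof.
have := mono1 (a := 0) (a' := a) b; rewrite normr0 N0b => /(_ (normr_ge0 a)).
exact: le_trans.
Qed.

(* the norm of a sum of n unit basis vectors *)
Let lam := fix lam n := if n is n'.+1 then N (lam n') 1 else 0.

Let lam_ge0 n : 0 <= lam n.
Proof. by case: n => [|n]; [exact: lexx|exact: N_ge0]. Qed.

Let lam1 : lam 1 = 1.
Proof. by rewrite /= N0b normr1. Qed.

Let lamD m n : lam (m + n) = N (lam m) (lam n).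
Proof.
elim: n => [|n ih]; first by rewrite addn0 /= Na0 ger0_norm.
by rewrite addnS /= ih NA.
Qed.

Let lamM m n : lam (m * n) = lam m * lam n.
Proof.
elim: n => [|n ih]; first by rewrite muln0 mulr0.
rewrite mulnS addnC lamD ih.
by rewrite -{2}[lam m]mulr1 NZ ger0_norm.
Qed.

Let lamX m k : lam (m ^ k)%N = lam m ^+ k.
Proof. by elim: k => [|k ih]; rewrite ?expn0 ?lam1// expnS lamM ih exprS. Qed.

Let lam_mono m n : (m <= n)%N -> lam m <= lam n.
Proof.
move=> /subnKC <-; rewrite lamD -{1}[lam m]ger0_norm// -Na0.
by apply: mono2; rewrite normr0.
Qed.

Let lam_gt0 n : (0 < n)%N -> 0 < lam n.
Proof. by move=> /lam_mono; apply: lt_le_trans; rewrite lam1. Qed.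

Let lam2_le2 : lam 2 <= 2.
Proof.
have := NT 1 0 0 1; rewrite !addr0 !add0r N0b Na0 normr1.
by rewrite /= N0b normr1.
Qed.

Let Nnorm a b : N a b = N `|a| `|b|.
Proof.
by apply: le_anti; apply/andP; split; apply: (le_trans (y := N `|a| b));
  [apply: mono1|apply: mono2|apply: mono2|apply: mono1]; rewrite normr_id.
Qed.

Let Nmax : lam 2 = 1 -> forall a b, N a b = lp2 +oo a b.
Proof.
rewrite [lam 2]/= N0b normr1 => l2 a b /=.
wlog ab : a b / `|a| <= `|b|.
  move=> h; have /orP[|] := le_total `|a| `|b|; first exact: h.
  (* N (b, a) = N (a, b) is not known, but both are bounded by the maximum *)
  move=> ba; apply: le_anti; apply/andP; split.
    apply: (le_trans (mono2 (b' := a) a ba)).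
    by have := NZ a 1 1; rewrite !mulr1 l2 mulr1 => ->; rewrite le_max lexx.
  rewrite ge_max -Na0 (mono2 a)/= ?normr0//.
  by apply: (le_trans ba); rewrite -Na0 (mono2 a)// normr0.
rewrite max_r//; apply: le_anti; apply/andP; split.
  apply: (le_trans (mono1 (a' := b) b ab)).
  by have := NZ b 1 1; rewrite !mulr1 l2 mulr1 => ->.
by rewrite -N0b mono1// normr0.
Qed.

Let alpha := ln (lam 2) / ln 2.

Let ln2_gt0 : 0 < ln 2 :> R.
Proof. by rewrite ln_gt0// ltr1n. Qed.

(* This follows from comparing n ^ k with the powers of 2, for all k. *)
Let lamE n : 1 < lam 2 -> (0 < n)%N -> lam n = n%:R `^ alpha.
Proof.
move=> l2 n0; have n0' : 0 < n%:R :> R by rewrite ltr0n.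
suff E : ln (lam n) = alpha * ln n%:R.
  by rewrite /powR gt_eqF// -E lnK// posrE lam_gt0.
apply: (@archimedean_eq R (ln (lam 2))) => k.
have nk0 : (0 < n ^ k)%N by rewrite expn_gt0 n0.
have /andP[] := trunc_log_bounds (isT : (1 < 2)%N) nk0.
set j := trunc_log 2 _ => j1 /ltnW j2.
have lnX (a : R) i : 0 < a -> ln (a ^+ i) = i%:R * ln a.
  by move=> a0; rewrite lnXn// mulr_natl.
have l2' : 0 < lam 2 by lra.
have h1 : j%:R * ln (lam 2) <= k%:R * ln (lam n).
  rewrite -!lnX ?lam_gt0// ler_ln ?posrE ?exprn_gt0 ?lam_gt0//.
  by rewrite -!lamX lam_mono.
have h2 : k%:R * ln (lam n) <= j.+1%:R * ln (lam 2).
  rewrite -!lnX ?lam_gt0// ler_ln ?posrE ?exprn_gt0 ?lam_gt0//.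
  by rewrite -!lamX lam_mono.
have h3 : j%:R * ln 2 <= k%:R * ln n%:R :> R.
  rewrite -!lnX// ler_ln ?posrE ?exprn_gt0//.
  by rewrite -!natrX ler_nat.
have h4 : k%:R * ln n%:R <= j.+1%:R * ln 2 :> R.
  rewrite -!lnX// ler_ln ?posrE ?exprn_gt0//.
  by rewrite -!natrX ler_nat.
have a0 : 0 < alpha by rewrite divr_gt0// ln_gt0.
have el : ln (lam 2) = alpha * ln 2 by rewrite divfK// gt_eqF.
have h5 : alpha * (j%:R * ln 2) <= alpha * (k%:R * ln n%:R) by rewrite ler_pM2l.
have h6 : alpha * (k%:R * ln n%:R) <= alpha * (j.+1%:R * ln 2) by rewrite ler_pM2l.
have e1 : alpha * (j%:R * ln 2) = j%:R * ln (lam 2) by rewrite el; ring.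
have e2 : alpha * (j.+1%:R * ln 2) = (j%:R + 1) * ln (lam 2).
  by rewrite el -natr1; ring.
have e3 : alpha * (k%:R * ln n%:R) = k%:R * (alpha * ln n%:R) by ring.
rewrite e3 e1 in h5; rewrite e3 e2 in h6; rewrite -natr1 in h2.
have -> : k%:R * `|ln (lam n) - alpha * ln n%:R| =
          `|k%:R * (ln (lam n) - alpha * ln n%:R)| by rewrite normrM normr_nat.
rewrite ler_norml mulrBr; lra.
Qed.

Let Npow : 1 < lam 2 -> forall a b, N a b = lp2 (alpha^-1)%:E a b.
Proof.
move=> l2 a b; have a0 : 0 < alpha by rewrite divr_gt0// ln_gt0.
have an : alpha != 0 by rewrite gt_eqF.
rewrite Nnorm /lp2 invrK; set q := alpha^-1.
have q0 : 0 < q by rewrite invr_gt0.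
have qa (s : R) : 0 <= s -> (s `^ alpha) `^ q = s.
  by move=> s0; rewrite -powRrM mulfV// powRr1.
have aq (s : R) : 0 <= s -> (s `^ q) `^ alpha = s.
  by move=> s0; rewrite -powRrM mulVf// powRr1.
have lamq n : lam n `^ q = n%:R.
  case: n => [|n]; first by rewrite /= powR0// gt_eqF.
  by rewrite lamE// qa.
have mono (u v : R) : 0 <= u -> u <= v -> u `^ q <= v `^ q.
  move=> u0 uv; apply: ge0_ler_powR; rewrite ?nnegrE//; first exact: ltW.
  exact: le_trans uv.
have monoa (u v : R) : 0 <= u -> u <= v -> u `^ alpha <= v `^ alpha.
  move=> u0 uv; apply: ge0_ler_powR; rewrite ?nnegrE//; first exact: ltW.
  exact: le_trans uv.
(* The equality is known when s and t are quotients of integers; the general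
   case follows by monotonicity. *)
suff E (s t : R) : 0 <= s -> 0 <= t -> N (s `^ alpha) (t `^ alpha) = (s + t) `^ alpha.
  rewrite -[in LHS](aq `|a|)// -[in LHS](aq `|b|)//.
  by rewrite E ?powR_ge0.
move=> s0 t0; set n0 := N _ _.
have n0_ge0 : 0 <= n0 by exact: N_ge0.
suff <- : n0 `^ q = s + t by rewrite aq.
apply: (@archimedean_eq R 2) => k.
case: k => [|k]; first by rewrite mul0r.
set K := k.+1.
have K0 : 0 <= K%:R :> R by exact: ler0n.
have kE : K%:R * n0 `^ q = (lam K * n0) `^ q by rewrite powRM// lamq.
have kN : lam K * n0 = N ((K%:R * s) `^ alpha) ((K%:R * t) `^ alpha).
  by rewrite !powRM// -(lamE l2 (isT : (0 < K)%N)) NZ ger0_norm.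
have [s1 s2] : (Num.truncn (K%:R * s))%:R <= K%:R * s /\
    K%:R * s <= (Num.truncn (K%:R * s)).+1%:R.
  by have /andP[h1 h2] := truncn_itv (mulr_ge0 K0 s0); split=> //; exact: ltW.
have [t1 t2] : (Num.truncn (K%:R * t))%:R <= K%:R * t /\
    K%:R * t <= (Num.truncn (K%:R * t)).+1%:R.
  by have /andP[h1 h2] := truncn_itv (mulr_ge0 K0 t0); split=> //; exact: ltW.
move: s1 s2 t1 t2; set n := Num.truncn _; set m := Num.truncn _ => s1 s2 t1 t2.
have lamA i (r : R) : i%:R <= r -> lam i <= r `^ alpha.
  case: i => [|i] ir; first exact: powR_ge0.
  by rewrite lamE// monoa.
have Nmono u v u' v' : 0 <= u -> u <= u' -> 0 <= v -> v <= v' -> N u v <= N u' v'.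
  move=> u0 uu' v0 vv'; apply: (le_trans (y := N u' v)).
    by apply: mono1; rewrite !ger0_norm// (le_trans u0).
  by apply: mono2; rewrite !ger0_norm// (le_trans v0).
have lo : (n + m)%:R <= K%:R * n0 `^ q.
  rewrite -(lamq (n + m)%N) kE kN mono// lamD; apply: Nmono => //; exact: lamA.
have hi : K%:R * n0 `^ q <= (n.+1 + m.+1)%:R.
  rewrite -(lamq (n.+1 + m.+1)%N) kE mono ?mulr_ge0// kN lamD.
  apply: Nmono; rewrite ?powR_ge0// lamE// monoa// mulr_ge0//.
have nS i : i.+1%:R = i%:R + 1 :> R by rewrite natr1.
rewrite natrD in lo; rewrite natrD (nS n) (nS m) in hi.
rewrite (nS n) in s2; rewrite (nS m) in t2.
rewrite -[X in X * _](ger0_norm K0) -normrM mulrBr mulrDr ler_norml; lra.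
Qed.

(** A norm on the plane which is invariant under sign changes and associative
    is an l_p norm. *)
Theorem associative_norm_lp :
  exists p : \bar R, (1%:E <= p)%E /\ forall a b, N a b = lp2 p a b.
Proof.
have : 1 <= lam 2 by rewrite -{1}lam1 lam_mono.
rewrite le_eqVlt => /predU1P[/esym l2|l2].
  by exists +oo%E; split; [rewrite leey|exact: Nmax].
exists (alpha^-1)%:E; split; last exact: Npow.
rewrite lee_fin invf_ge1; last by rewrite divr_gt0// ln_gt0.
rewrite ler_pdivrMr// mul1r ler_ln ?posrE//; last by lra.
Qed.

End Bohnenblust.

(** * Asymptotic pairs span an l_p plane *)

(** The filter of the pairs which satisfy [B], both vectors being far out and
    the second one far beyond the first. *)
Definition pair_filter (R : realType) (X : normedModType R) (x : nat -> X)
    (B : X -> X -> Prop) : set_system (X * X) :=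
  [set P | exists m, forall y, fsphere x m y ->
     (forall m', exists w, fsphere x m' w /\ B y w) ->
     exists m', forall w, fsphere x m' w -> B y w -> P (y, w)].

Section PairFilter.
Context (R : realType) (X : completeNormedModType R) (x : nat -> X).
Hypothesis hx : schauder_basis x.

Lemma pair_filter_proper (B : X -> X -> Prop) :
  (forall m, exists y, fsphere x m y /\
     forall m', exists w, fsphere x m' w /\ B y w) ->
  ProperFilter (pair_filter x B).
Proof.
move=> hB; split.
  move=> [m hm]; have [y [ym yB]] := hB m.
  have [m' hm'] := hm y ym yB; have [w [wm wB]] := yB m'.
  exact: hm' wm wB.
split.
- by exists 0%N => y _ _; exists 0%N.
- move=> P Q [m hm] [n hn]; exists (maxn m n) => y ym yB.
  have [m' hm'] := hm y (fsphereW (leq_maxl _ _) ym) yB.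
  have [n' hn'] := hn y (fsphereW (leq_maxr _ _) ym) yB.
  exists (maxn m' n') => w wm wB; split.
    by apply: hm' => //; exact: fsphereW (leq_maxl _ _) wm.
  by apply: hn' => //; exact: fsphereW (leq_maxr _ _) wm.
move=> P Q PQ [m hm]; exists m => y ym yB.
have [m' hm'] := hm y ym yB; exists m' => w wm wB.
by apply: PQ; exact: hm' wB.
Qed.

Lemma pair_filter_bounds (B : X -> X -> Prop) : exists c : R, 0 < c /\
  pair_filter x B [set t | [/\ `|t.1| = 1, `|t.2| = 1 &
    forall a b : R, c * `|a| <= `|a *: t.1 + b *: t.2| /\
                    c * `|b| <= `|a *: t.1 + b *: t.2|]].
Proof.
have [c [c0 hc]] := successive_lower_bound hx; exists c; split=> //.
exists 0%N => y y1 _; exists (supp_end x y) => w w1 _; split=> /=.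
- by have [] := y1.
- by have [] := w1.
by move=> a b; exact: hc y1 w1 a b.
Qed.

Lemma asymptotic_pair_cvg (N : R -> R -> R) : asymptotic_pair x N ->
  forall a b, `|a *: t.1 + b *: t.2| @[t --> pair_filter x (fun _ _ => True)]
    --> N a b.
Proof.
move=> hN a b.
have hB m : exists y, fsphere x m y /\
     forall m', exists w, fsphere x m' w /\ True.
  have [y hy] := fsphere_nonempty hx m; exists y; split=> // m'.
  by have [w hw] := fsphere_nonempty hx m'; exists w.
have PF := pair_filter_proper hB.
have N0 : 0 <= N a b.
  have [m hm] := hN 1 ltr01; have [y hy] := fsphere_nonempty hx m.
  have [m' hm'] := hm y hy; have [w hw] := fsphere_nonempty hx m'.
  have /andP[_] := hm' w hw a b; have := normr_ge0 (a *: y + b *: w); lra.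
apply/cvgrPdist_lt => d d0.
pose e := Num.min 1 (d / (2 * N a b + 1)).
have e0 : 0 < e by rewrite lt_min ltr01 divr_gt0//; lra.
have [e1 ed] : e <= 1 /\ e * (2 * N a b + 1) <= d.
  split; first by rewrite /e ge_min lexx.
  rewrite -ler_pdivlMr; last by lra.
  by rewrite /e ge_min lexx orbT.
have [m hm] := hN e e0; exists m => y /hm[m' hm'] _.
exists m' => w /hm'/(_ a b)/andP[h1 h2] _ /=.
rewrite ler_pdivrMl in h1; last by lra.
set f := `|_ + _| in h1 h2 *.
have h3 : e * f <= e * (2 * N a b).
  rewrite ler_pM2l//; apply: le_trans h2 _.
  by rewrite ler_wpM2r//; lra.
have h4 : 0 <= e * N a b by rewrite mulr_ge0// ltW.
rewrite ltr_norml; lra.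
Qed.

Lemma le_approx4 (u v : R) : 0 <= v ->
  (forall e : R, 0 < e -> u <= (1 + e) ^+ 4 * v) -> u <= v.
Proof.
move=> v0 h; apply/ler_addgt0Pr => d d0.
pose e := Num.min 1 (d / (15 * v + 1)).
have e0 : 0 < e by rewrite lt_min ltr01 divr_gt0//; lra.
have [e1 ed] : e <= 1 /\ e * (15 * v + 1) <= d.
  split; first by rewrite /e ge_min lexx.
  rewrite -ler_pdivlMr; last by lra.
  by rewrite /e ge_min lexx orbT.
apply: le_trans (h e e0) _.
have : (1 + e) ^+ 4 <= 1 + 15 * e.
  have e2 : e ^+ 2 <= e by rewrite expr2 ler_piMr// ltW.
  have e3 : e ^+ 3 <= e ^+ 2 by rewrite exprS ler_piMl// ?exprn_ge0// ltW.
  have e4 : e ^+ 4 <= e ^+ 3 by rewrite exprS ler_piMl// ?exprn_ge0// ltW.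
  have -> : (1 + e) ^+ 4 = 1 + 4 * e + 6 * e ^+ 2 + 4 * e ^+ 3 + e ^+ 4 by ring.
  lra.
move=> /(ler_wpM2r v0) h1; apply: le_trans h1 _; lra.
Qed.

(** The norm of an asymptotic pair is sign invariant, because the unit spheres
    are, and associative: [N (N a b) c] and [N a (N b c)] are both close to the
    norm of [a y1 + b y2 + c y3] for suitable [y1], [y2], [y3]. *)
Theorem asymptotic_pair_lp (N : R -> R -> R) : asymptotic_pair x N ->
  exists p : \bar R, (1%:E <= p)%E /\ asymptotic_pair x (lp2 p).
Proof.
move=> hN; have hcvg := asymptotic_pair_cvg hN.
have hB m : exists y, fsphere x m y /\
     forall m', exists w, fsphere x m' w /\ True.
  have [y hy] := fsphere_nonempty hx m; exists y; split=> // m'.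
  by have [w hw] := fsphere_nonempty hx m'; exists w.
have PF := pair_filter_proper hB.
have [c [c0 hc]] := pair_filter_bounds (fun _ _ => True).
have NZ := @pair_limitZ _ _ _ _ PF _ _ _ hcvg.
have NT := @pair_limit_triangle _ _ _ _ PF _ _ _ hcvg.
have N_ge0 a b : 0 <= N a b.
  have [h _] := pair_limit_ge hc hcvg a b.
  by apply: le_trans h; rewrite mulr_ge0// ltW.
have Na0 a : N a 0 = `|a|.
  apply: (cvg_unique (@Rhausdorff R) (hcvg a 0)); apply: cvg_near_cst.
  exists 0%N => y [_ y1] _; exists 0%N => w _ _ /=.
  by rewrite scale0r addr0 normrZ y1 mulr1.
have N0b b : N 0 b = `|b|.
  apply: (cvg_unique (@Rhausdorff R) (hcvg 0 b)); apply: cvg_near_cst.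
  exists 0%N => y _ _; exists 0%N => w [_ w1] _ /=.
  by rewrite scale0r add0r normrZ w1 mulr1.
have fsN m y : fsphere x m y -> fsphere x m (- y).
  by move=> [ym y1]; split; [rewrite -scaleN1r; exact: ftailZ|rewrite normrN].
have pw4 (e : R) : 0 < e -> (1 + e) ^+ 2 <= (1 + e) ^+ 4.
  by move=> e0; rewrite ler_weXn2l//; lra.
have Nsgn_le a b : N (- a) b <= N a b.
  apply: le_approx4 => // e e0; have [m hm] := hN e e0.
  have [y hy] := fsphere_nonempty hx m.
  have [m1 h1] := hm _ hy; have [m2 h2] := hm _ (fsN _ _ hy).
  have [w hw] := fsphere_nonempty hx (maxn m1 m2).
  have /andP[_ u1] := h1 w (fsphereW (leq_maxl _ _) hw) a b.
  have /andP[u2 _] := h2 w (fsphereW (leq_maxr _ _) hw) (- a) b.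
  rewrite scalerN scaleNr opprK ler_pdivrMl in u2; last by lra.
  apply: le_trans u2 _; apply: (le_trans (y := (1 + e) * ((1 + e) * N a b))).
    by rewrite ler_pM2l//; lra.
  by rewrite mulrA -expr2 ler_wpM2r// pw4.
have Nsgn a b : N (- a) b = N a b.
  apply: le_anti; rewrite Nsgn_le /=.
  by have := Nsgn_le (- a) b; rewrite opprK.
have mono1 := norm_fst_mono NZ NT Nsgn.
have mono2 a b b' : `|b| <= `|b'| -> N a b <= N a b'.
  apply: (@norm_fst_mono R (fun u v => N v u)) => [s u v|u v u' v'|u v].
  - exact: NZ.
  - exact: NT.
  by have := NZ (-1) v (- u); rewrite mulrNN !mul1r normrN1 mul1r mulN1r Nsgn.
have stretch1 (q : R) a b : 1 <= q -> N (q * a) b <= q * N a b.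
  move=> q1; have q0 : 0 <= q by lra.
  have <- : N (q * a) (q * b) = q * N a b by rewrite NZ ger0_norm.
  by apply: mono2; rewrite normrM ler_peMl// ger0_norm.
have stretch2 (q : R) a b : 1 <= q -> N a (q * b) <= q * N a b.
  move=> q1; have q0 : 0 <= q by lra.
  have <- : N (q * a) (q * b) = q * N a b by rewrite NZ ger0_norm.
  by apply: mono1; rewrite normrM ler_peMl// ger0_norm.
have assoc_aux a b d (e : R) : 0 < e -> exists r : R,
    [/\ N (N a b) d <= (1 + e) ^+ 2 * r, r <= (1 + e) ^+ 2 * N (N a b) d,
        N a (N b d) <= (1 + e) ^+ 2 * r & r <= (1 + e) ^+ 2 * N a (N b d)].
  move=> e0; have q1 : 1 <= 1 + e by lra.
  have q0 : 0 < 1 + e by lra.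
  have [m hm] := hN e e0; have [y1 hy1] := fsphere_nonempty hx m.
  have [m1 h1] := hm _ hy1.
  have [y2 hy2] := fsphere_nonempty hx (maxn m m1).
  have hy2m := fsphereW (leq_maxl _ _) hy2.
  have hy2m1 := fsphereW (leq_maxr _ _) hy2.
  have [m2 h2] := hm _ hy2m.
  pose v := a *: y1 + b *: y2.
  have tv : ftail x m v.
    by apply: ftailD => //; apply: ftailZ => //; [case: hy1|case: hy2m].
  (* v may vanish, in which case it cannot be normalized *)
  have [m3 h3] : exists m3, forall w, fsphere x m3 w ->
      (1 + e)^-1 * N `|v| d <= `|v + d *: w| <= (1 + e) * N `|v| d.
    have [v0|v0] := eqVneq v 0.
      exists 0%N => w [_ w1].
      rewrite v0 normr0 add0r N0b normrZ w1 mulr1 ler_peMl// andbT.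
      by rewrite ler_pdivrMl// ler_peMl.
    have [m3 h3] := hm _ (ftail_normalize hx tv v0); exists m3 => w /h3.
    by move=> /(_ `|v| d); rewrite scalerA mulfV ?normr_eq0// scale1r.
  have [y3 hy3] := fsphere_nonempty hx (maxn m1 (maxn m2 m3)).
  have hy3m1 := fsphereW (leq_maxl _ _) hy3.
  have hy3m2 := fsphereW (leq_maxl _ _) (fsphereW (leq_maxr _ _) hy3).
  have hy3m3 := fsphereW (leq_maxr _ _) (fsphereW (leq_maxr _ _) hy3).
  pose u := b *: y2 + d *: y3.
  have tu : ftail x m1 u.
    by apply: ftailD => //; apply: ftailZ => //; [case: hy2m1|case: hy3m1].
  have u4 : (1 + e)^-1 * N a `|u| <= `|a *: y1 + u| <= (1 + e) * N a `|u|.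
    have [u0|u0] := eqVneq u 0.
      rewrite u0 normr0 addr0 Na0 normrZ (proj2 hy1) mulr1 ler_peMl// andbT.
      by rewrite ler_pdivrMl// ler_peMl.
    have := h1 _ (ftail_normalize hx tu u0) a `|u|.
    by rewrite scalerA mulfV ?normr_eq0// scale1r.
  exists `|v + d *: y3|.
  have := h3 _ hy3m3; have := h1 _ hy2m1 a b; have := h2 _ hy3m2 b d.
  rewrite -/u -/v => /andP[u1 u2] /andP[v1 v2] /andP[w1 w2].
  have E : a *: y1 + u = v + d *: y3 by rewrite /u /v addrA.
  rewrite E in u4; have /andP[z1 z2] := u4.
  rewrite ler_pdivrMl// in u1; rewrite ler_pdivrMl// in v1.
  rewrite ler_pdivrMl// in w1; rewrite ler_pdivrMl// in z1.
  have comp (s t r : R) : s <= (1 + e) * t -> t <= (1 + e) * r ->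
      s <= (1 + e) ^+ 2 * r.
    move=> h h'; apply: le_trans h _; rewrite expr2 -mulrA ler_pM2l//.
  split.
  - apply: comp w1; apply: le_trans (stretch1 _ _ _ q1).
    by apply: mono1; rewrite !ger0_norm ?mulr_ge0// ltW.
  - apply: (comp _ _ _ w2); apply: le_trans (stretch1 _ _ _ q1).
    by apply: mono1; rewrite normr_id ger0_norm ?mulr_ge0// ltW.
  - apply: comp z1; apply: le_trans (stretch2 _ _ _ q1).
    by apply: mono2; rewrite !ger0_norm ?mulr_ge0// ltW.
  - apply: (comp _ _ _ z2); apply: le_trans (stretch2 _ _ _ q1).
    by apply: mono2; rewrite normr_id ger0_norm ?mulr_ge0// ltW.
have comp4 (e s t r : R) : 0 < e -> s <= (1 + e) ^+ 2 * t ->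
    t <= (1 + e) ^+ 2 * r -> s <= (1 + e) ^+ 4 * r.
  move=> e0 h h'; apply: le_trans h _.
  have -> : (1 + e) ^+ 4 * r = (1 + e) ^+ 2 * ((1 + e) ^+ 2 * r) by ring.
  by rewrite ler_pM2l// exprn_gt0//; lra.
have NA a b d : N (N a b) d = N a (N b d).
  apply: le_anti; apply/andP; split; apply: le_approx4 => // e e0;
    have [r [h1 h2 h3 h4]] := assoc_aux a b d e e0; exact: (comp4 e _ r).
have [p [p1 Np]] := associative_norm_lp NZ NT Na0 N0b Nsgn NA.
exists p; split=> //.
suff <- : N = lp2 p by [].
by apply/funext => a; apply/funext => b.
Qed.

End PairFilter.

(** * Labels of a tree *)

(** The elements of a finite set of labels, in increasing order. *)
Definition labels (A : {fset nat}) : seq nat := sort leq (enum_fset A).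

Lemma labels_sorted A : sorted ltn (labels A).
Proof.
rewrite ltn_sorted_uniq_leq sort_uniq fset_uniq /=.
by apply: sort_sorted; exact: leq_total.
Qed.

Lemma mem_labels (A : {fset nat}) i : (i \in labels A) = (i \in A).
Proof. by rewrite mem_sort. Qed.

Lemma labels_unique (A : {fset nat}) s : sorted ltn s -> (forall i, (i \in s) = (i \in A)) ->
  labels A = s.
Proof.
move=> ss sA; apply: (irr_sorted_eq ltn_trans ltnn) => //.
  exact: labels_sorted.
by move=> i; rewrite mem_labels sA.
Qed.

Lemma labels_above (A : {fset nat}) m : (\max_(i <- A) i.+1 <= m)%N ->
  labels (m |` A)%fset = rcons (labels A) m.
Proof.
move=> Am; apply: labels_unique.
  rewrite (sorted_pairwise ltn_trans) pairwise_rcons -(sorted_pairwise ltn_trans).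
  rewrite labels_sorted andbT; apply/allP => i; rewrite mem_labels => iA /=.
  apply: leq_trans Am.
  exact: (@leq_bigmax_seq _ (enum_fset A) xpredT (fun i => i.+1) i).
by move=> i; rewrite mem_rcons in_fset1U inE mem_labels.
Qed.

Lemma labels_branch (k : nat -> nat) n : (forall i j, (i < j)%N -> (k i < k j)%N) ->
  labels [fset k i | i in iota 0 n]%fset = mkseq k n.
Proof.
move=> kmon; apply: labels_unique.
  by apply: homo_sorted (iota_ltn_sorted 0 n) => i j; exact: kmon.
move=> i; apply/mapP/imfsetP => -[j /= jn ->]; exists j => //.
Qed.

(** * From good branches to asymptotic pairs *)

(** The nodes of level [3 q + 1], [3 q + 2] and [3 q + 3] are taken from [u],
    from [v], and from the block sequence [w] attached to the previous node. *)
Definition tree3 (T : Type) (u v : nat -> T) (w : nat -> nat -> T)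
    (A : {fset nat}) : T :=
  let s := labels A in
  match (size s %% 3)%N with
  | 1%N => u (last 0%N s)
  | 2%N => v (last 0%N s)
  | _ => w (nth 0%N s (size s - 2)) (last 0%N s)
  end.

Lemma tree3_branch (R : realType) (X : normedModType R)
    (u v : nat -> X) (w : nat -> nat -> X) (k : nat -> nat) :
  (forall i j, (i < j)%N -> (k i < k j)%N) ->
  forall q, [/\ branch (tree3 u v w) k (3 * q)%N = u (k (3 * q)%N),
    branch (tree3 u v w) k (3 * q).+1 = v (k (3 * q).+1) &
    branch (tree3 u v w) k (3 * q).+2 = w (k (3 * q).+1) (k (3 * q).+2)].
Proof.
move=> kmon q.
have lastk n : last 0%N (mkseq k n.+1) = k n by rewrite mkseqS last_rcons.
have m1 : ((3 * q).+1 %% 3 = 1)%N by lia.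
have m2 : ((3 * q).+2 %% 3 = 2)%N by lia.
have m3 : ((3 * q).+3 %% 3 = 0)%N by lia.
rewrite /branch /tree3 !labels_branch// !size_mkseq !lastk m1 m2 m3.
by split=> //; rewrite nth_mkseq; [congr (w (k _) _); lia|lia].
Qed.

Lemma block_sequence_shift (R : realType) (X : normedModType R) (x z : nat -> X)
    (c : nat) :
  block_sequence x z -> block_sequence x (fun n => z (c + n)%N).
Proof. by move=> [h1 h2]; split=> i; [exact: h1|rewrite addnS; exact: h2]. Qed.

Lemma tree3_block (R : realType) (X : normedModType R) (x u v : nat -> X)
    (w : nat -> nat -> X) :
  block_sequence x u -> block_sequence x v ->
  (forall i, block_sequence x (w i)) -> block_tree x (tree3 u v w).
Proof.
move=> hu hv hw A; rewrite /nodes_below.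
set c := (\max_(i <- A) i.+1)%N.
have E n : tree3 u v w ((c + n)%N |` A)%fset =
    match ((size (labels A)).+1 %% 3)%N with
    | 1%N => u (c + n)%N
    | 2%N => v (c + n)%N
    | _ => w (nth 0%N (labels A) (size (labels A) - 1)) (c + n)%N
    end.
  rewrite /tree3 labels_above ?leq_addr// size_rcons last_rcons.
  case E : (_ %% 3)%N => [|[|[|j]]] //; congr (w _ _);
    rewrite nth_rcons ifT; first [by congr nth; lia | lia].
rewrite (funext E).
by case: (_ %% 3)%N => [|[|[|j]]]; exact: block_sequence_shift.
Qed.

Lemma good_pairs (R : realType) (X : normedModType R) (y : nat -> X) :
  good_sequence y -> forall a b : R, exists L : R, forall eps : R, 0 < eps ->
    exists K, forall i j, (K <= i)%N -> (i < j)%N ->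
      `| `|a *: y i + b *: y j| - L | < eps.
Proof.
move=> [_ _ hy] a b.
have [L hL] := hy 2%N (fun i => if i == ord0 then a else b).
exists L => eps e0; have [K hK] := hL eps e0; exists K => i j Ki ij.
have := hK (fun l => if l == ord0 then i else j).
rewrite !big_ord_recl big_ord0 /= addr0; apply.
  move=> [[|[|l]] hl] [[|[|l']] hl'] //=.
by move=> l; case: ifP => // _; apply: leq_trans Ki (ltnW ij).
Qed.

Section GoodBranches.
Context (R : realType) (X : completeNormedModType R) (x : nat -> X).
Hypothesis hx : schauder_basis x.
Hypothesis good : forall T : {fset nat} -> X,
  normalized_tree T -> block_tree x T -> has_good_branch T.

Lemma tree3_good (u v : nat -> X) (w : nat -> nat -> X) :
  block_sequence x u -> block_sequence x v ->
  (forall i, block_sequence x (w i)) ->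
  (forall i, `|u i| = 1) -> (forall i, `|v i| = 1) ->
  (forall i j, `|w i j| = 1) ->
  exists k, (forall i j, (i < j)%N -> (k i < k j)%N) /\
    good_sequence (branch (tree3 u v w) k).
Proof.
move=> hu hv hw u1 v1 w1; apply: good; last exact: tree3_block.
by move=> A _; rewrite /tree3; case: (_ %% 3)%N => [|[|[|j]]].
Qed.

(** A good branch of the tree of basis vectors provides a good sequence [z]
    and the limit [N] of the norms of its pairs.  If arbitrarily far out there
    were pairs not close to [N], they would be nodes of a tree all of whose
    branches also have infinitely many nodes in common with [z]; on a good
    branch of it the norms of these pairs converge to [N] as well. *)
Theorem good_branches_asymptotic_pair :
  exists N : R -> R -> R, asymptotic_pair x N.
Proof.
pose e i := `|x i|^-1 *: x i.
have ex i : forall j, coef x (e i) j = `|x i|^-1 * (j == i)%:R.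
  by move=> j; rewrite coef_scale// coef_basis.
have ft i : ftail x i (e i).
  split=> [j ji|]; first by rewrite ex ltn_eqF// mulr0.
  by exists i.+1 => j ij; rewrite ex gtn_eqF// mulr0.
have e1 i : `|e i| = 1 by rewrite normfZV// basis_neq0.
have e0 i : e i != 0 by rewrite -normr_eq0 e1 oner_eq0.
have esub (k : nat -> nat) : (forall i j, (i < j)%N -> (k i < k j)%N) ->
    block_sequence x (e \o k).
  move=> kmon; split=> i /=.
    split=> //; exists (coef x (e (k i))); apply: coef_finite_expansion => //.
    exact: ftailW (ft (k i)).
  apply/successiveP => //; split; [exact: ftailW (ft _)|exact: ftailW (ft _)|].
  move=> j j'; rewrite !ex; have [->|_] := eqVneq j; last by rewrite mulr0 eqxx.
  have [->|_] := eqVneq j'; last by rewrite mulr0 eqxx.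
  by move=> _ _; exact: kmon.
have be : block_sequence x e by exact: (esub id).
have [k [kmon kgood]] := tree3_good be be (fun _ => be) e1 e1 (fun _ => e1).
pose z := e \o k.
have zE : branch (tree3 e e (fun=> e)) k = z.
  apply/funext => n; have [h0 h1 h2] := tree3_branch e e (fun=> e) kmon (n %/ 3).
  have := divn_eq n 3; rewrite [X in _ = (X + _)%N]mulnC.
  have : (n %% 3 < 3)%N by rewrite ltn_mod.
  case: (n %% 3)%N => [|[|[|j]]]// _ E.
  - by rewrite E addn0 h0.
  - by rewrite E addn1 h1.
  - by rewrite E addn2 h2.
rewrite zE in kgood.
have [N0 hN0] := choice (fun ab : R * R => good_pairs kgood ab.1 ab.2).
pose N a b := N0 (a, b); exists N; apply: contrapT => hno.
have [eps [eps0 hbad]] : exists eps : R, 0 < eps /\ forall m, exists y,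
    fsphere x m y /\ forall m', exists w, fsphere x m' w /\
      ~ okpair (1 + eps) N y w.
  apply: contrapT => h; apply: hno => eps eps0; apply: contrapT => h'.
  apply: h; exists eps; split=> // m; apply: contrapT => hm; apply: h'.
  exists m => y ym; apply: contrapT => hy; apply: hm; exists y; split=> // m'.
  apply: contrapT => hm'; apply: hy; exists m' => w wm'.
  by apply: contrapT => hw; apply: hm'; exists w.
have [s hs] := choice hbad.
have [v [vb v1 vs]] := block_sequence_of_choice hx 0 (fun m => (hs m).1).
have hw i : exists w, [/\ block_sequence x w, forall n, `|w n| = 1 &
    forall n, fsphere x (supp_end x (v i)) (w n) /\ ~ okpair (1 + eps) N (v i) (w n)].
  have [m _ vim] := vs i.
  have [r hr] := choice (hs m).2.
  have [w [wb w1 wr]] := block_sequence_of_choice hx (supp_end x (v i))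
    (fun m => (hr m).1).
  exists w; split=> // n; have [m' vm' ->] := wr n.
  by split; [exact: fsphereW (hr m').1|rewrite vim; exact: (hr m').2].
have [w hw'] := choice hw.
have zb : block_sequence x z by exact: esub.
have z1 i : `|z i| = 1 by exact: e1.
have wb i : block_sequence x (w i) by have [] := hw' i.
have w1 i j : `|w i j| = 1 by have [_ h _] := hw' i; exact: h.
have [l [lmon lgood]] := tree3_good zb vb wb z1 v1 w1.
pose y := branch (tree3 z v w) l.
have yE := tree3_branch z v w lmon.
have lge i : (i <= l i)%N.
  by elim: i => // i ih; apply: leq_ltn_trans ih _; exact: lmon.
(* the levels 3 q of the good branch are nodes of z, so its limit is N *)
have ylim a b (d : R) : 0 < d -> exists K, forall i j, (K <= i)%N -> (i < j)%N ->
    `| `|a *: y i + b *: y j| - N a b | < d.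
  move=> d0; have [L hL] := good_pairs lgood a b.
  suff -> : N a b = L by exact: hL.
  apply/eqP; rewrite -subr_eq0 -normr_le0; apply/ler_addgt0Pr => c c0.
  have c2 : 0 < c / 2 by rewrite divr_gt0.
  have [K1 h1] := hL _ c2; have [K2 h2] := hN0 (a, b) _ c2.
  pose q := maxn K1 K2.
  have q1 : (K1 <= 3 * q)%N by rewrite /q; lia.
  have q2 : (K2 <= 3 * q)%N by rewrite /q; lia.
  have qq : (3 * q < 3 * q.+1)%N by lia.
  have := h1 _ _ q1 qq.
  have [-> _ _] := yE q; have [-> _ _] := yE q.+1.
  have := h2 _ _ (leq_trans q2 (lge _)) (lmon _ _ qq).
  rewrite -/(N a b) /= distrC => g1 g2.
  have := ler_distD (`|a *: z (l (3 * q)%N) + b *: z (l (3 * q.+1)%N)|) (N a b) L.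
  rewrite add0r; lra.
have [c [c0 hc]] := successive_lower_bound hx.
have yv q : exists i j, y (3 * q).+1 = v i /\ y (3 * q).+2 = w i j.
  by have [_ h1 h2] := yE q; exists (l (3 * q).+1), (l (3 * q).+2).
have [||Q _ /(_ Q (leqnn Q))] := @pair_limit_uniform R X nat \oo _
  (fun q => y (3 * q).+1) (fun q => y (3 * q).+2) N c c0 _ _ eps eps0.
- exists 0%N => // q _; have [i [j [-> ->]]] := yv q.
  have [m _ vm] := vs i; have [_ _ /(_ j)[wij _]] := hw' i.
  split=> // a b; apply: (hc m) => //.
  by rewrite vm; exact: (hs m).1.
- move=> a b; apply/cvg_seqP => d d0; have [K hK] := ylim a b d d0.
  exists K => q Kq; rewrite distrC; apply: hK; last by [].
  by apply: leq_trans Kq _; lia.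
have [i [j [-> ->]]] := yv Q.
by have [_ _ /(_ j)[_]] := hw' i.
Qed.

End GoodBranches.

(** * Norms on the plane *)

Section Plane.
Context (R : realType) (N : R -> R -> R) (c : R).
Hypothesis c0 : 0 < c.
Hypothesis NZ : forall s a b, N (s * a) (s * b) = `|s| * N a b.
Hypothesis NT : forall a b a' b', N (a + a') (b + b') <= N a b + N a' b'.
Hypothesis Nge : forall a b, c * `|a| <= N a b /\ c * `|b| <= N a b.
Hypothesis Nle : forall a b, N a b <= `|a| + `|b|.

(** [R * R] with the norm [N], which is equivalent to the product norm. *)
Definition plane : Type := (R^o * R^o)%type.

HB.instance Definition _ := GRing.Lmodule.copy plane (R^o * R^o)%type.

Let plane_norm (v : plane) : R := N v.1 v.2.

Let plane_normD (u v : plane) : plane_norm (u + v) <= plane_norm u + plane_norm v.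
Proof. exact: NT. Qed.

Let plane_normZ (l : R) (v : plane) : plane_norm (l *: v) = `|l| * plane_norm v.
Proof. exact: NZ. Qed.

Let plane_norm0_eq0 (v : plane) : plane_norm v = 0 -> v = 0.
Proof.
case: v => a b; rewrite /plane_norm/= => h; have [] := Nge a b; rewrite h.
rewrite !pmulr_rle0// !normr_le0 => /eqP -> /eqP ->; reflexivity.
Qed.

HB.instance Definition _ :=
  Lmodule_isNormed.Build R plane plane_normD plane_normZ plane_norm0_eq0.

Let plane_normE (v : plane) : `|v| = N v.1 v.2.
Proof. by []. Qed.

Let plane_complete (F : set_system plane) : ProperFilter F -> cauchy F -> cvg F.
Proof.
move=> FF /cauchyP hF.
have cvg1 (f : plane -> R) : (forall u v, c * `|f u - f v| <= `|u - v|) ->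
    exists l : R, f @ F --> l.
  move=> hf; have : cauchy (f @ F).
    apply/cauchyP => e e0; have [y hy] := hF (c * e) (mulr_gt0 c0 e0).
    exists (f y); suff: F (f @^-1` ball (f y) e) by [].
    apply: filterS hy => z; rewrite -!ball_normE /= => hz.
    by rewrite -(ltr_pM2l c0); exact: le_lt_trans (hf y z) hz.
  by move=> /cauchy_cvg/cvg_ex.
have [l1 h1] : exists l : R, (fun v : plane => v.1 : R) @ F --> l.
  by apply: cvg1 => u v; exact: (Nge (u.1 - v.1) (u.2 - v.2)).1.
have [l2 h2] : exists l : R, (fun v : plane => v.2 : R) @ F --> l.
  by apply: cvg1 => u v; exact: (Nge (u.1 - v.1) (u.2 - v.2)).2.
apply/cvg_ex; exists ((l1, l2) : plane); apply/cvgrPdist_lt => e e0.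
have e2 : 0 < e / 2 by rewrite divr_gt0.
move/cvgrPdist_lt/(_ _ e2) : h1 => h1; move/cvgrPdist_lt/(_ _ e2) : h2 => h2.
near=> v.
have v1 : `|l1 - v.1| < e / 2 by near: v.
have v2 : `|l2 - v.2| < e / 2 by near: v.
by rewrite plane_normE /=; apply: le_lt_trans (Nle _ _) _; lra.
Unshelve. all: by end_near. Qed.

HB.instance Definition _ := Uniform_isComplete.Build plane plane_complete.

Lemma plane_exists : exists (E : completeNormedModType R) (e : 'I_2 -> E),
  finite_basis e /\ forall a, comb_norm e a = N (a ord0) (a (lift ord0 ord0)).
Proof.
pose e (i : 'I_2) : plane := if i == ord0 then (1, 0) else (0, 1).
have eE a : \sum_(i < 2) a i *: e i = (a ord0, a (lift ord0 ord0)) :> plane.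
  rewrite !big_ord_recl big_ord0 /e /= addr0.
  by congr (_, _); rewrite /= /GRing.scale/= ?mulr0 ?mulr1 ?addr0 ?add0r.
exists plane, e; split=> [[a b]|a]; last by rewrite /comb_norm eE.
exists (fun i => if i == ord0 then a else b); split; first by rewrite eE.
move=> a' ; rewrite eE => -[-> ->]; apply/funext => -[[|[|i]] hi] //=.
  by congr a'; apply: val_inj.
by congr a'; apply: val_inj.
Qed.

End Plane.

(** * From asymptotic spaces to asymptotic pairs *)

Section Converse.
Context (R : realType) (X : completeNormedModType R) (x : nat -> X).
Hypothesis hx : schauder_basis x.
Context (p : \bar R).
Hypothesis p1 : (1%:E <= p)%E.

(** If the pairs not close to [lp2 p] existed arbitrarily far out, an
    ultrafilter would select among them a limit norm [N] on the plane, which is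
    an asymptotic space, hence equal to [lp2 p]; but most pairs are close to
    their limit. *)
Theorem asymptotic_lp_pair : asymptotic_lp x 1 p -> asymptotic_pair x (lp2 p).
Proof.
move=> hlp eps e0; apply: contrapT => hno.
pose B y w := ~ okpair (1 + eps) (lp2 p) (y : X) w.
have hB m : exists y, fsphere x m y /\
     forall m', exists w, fsphere x m' w /\ B y w.
  apply: contrapT => hm; apply: hno.
  exists m => y ym; apply: contrapT => hy; apply: hm; exists y; split=> // m'.
  apply: contrapT => hm'; apply: hy; exists m' => w wm'.
  by apply: contrapT => hw; apply: hm'; exists w.
have PF := pair_filter_proper hB.
have [c [c0 hc]] := pair_filter_bounds hx B.
have [G [GU FG]] := ultraFilterLemma PF.
have PG : ProperFilter G by exact: ultra_proper.
have hcG := FG _ hc.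
have lim a b : exists l : R, `|a *: t.1 + b *: t.2| @[t --> G] --> l.
  pose f (t : X * X) := `|a *: t.1 + b *: t.2| : R.
  have cK : compact `[0, `|a| + `|b|]%classic by exact: segment_compact.
  have fGK : (f @ G) `[0, `|a| + `|b|]%classic.
    suff: G (f @^-1` `[0, `|a| + `|b|]%classic) by [].
    apply: filterS hcG => -[y w] [/= y1 w1 _].
    rewrite /f in_itv /= normr_ge0 /=.
    by apply: le_trans (ler_normD _ _) _; rewrite !normrZ y1 w1 !mulr1.
  have [l [_ hl]] := cK (f @ G) _ fGK.
  exists l => A lA; have [//|GnA] := in_ultra_setVsetC (f @^-1` A) GU.
  by have [r [/= nAr Ar]] := hl (~` A) A GnA lA.
have [N0 hN0] := choice (fun ab : R * R => lim ab.1 ab.2).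
pose N a b := N0 (a, b).
have hN a b : `|a *: t.1 + b *: t.2| @[t --> G] --> N a b by exact: (hN0 (a, b)).
have unif := @pair_limit_uniform _ _ _ _ PG _ _ _ _ c0 hcG hN.
have [E [e [ebasis eN]]] := plane_exists c0
  (@pair_limitZ _ _ _ _ PG _ _ _ hN) (@pair_limit_triangle _ _ _ _ PG _ _ _ hN)
  (@pair_limit_ge _ _ _ _ PG _ _ _ _ hcG hN)
  (@pair_limit_le _ _ _ _ PG _ _ _ _ hcG hN).
have easym : asymptotic_space x e.
  move=> d d0 /=; apply: contrapT => hne.
  (* a winning strategy of the first player in the game of length two *)
  have [m hm] : exists m, forall y, tail_sphere x m y -> exists m', forall w,
      tail_sphere x m' w -> ~ (
      let u := fun i : 'I_2 => nth 0 [:: y; w] i in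
      finite_block_sequence x u /\
      equivalent (1 + d) (comb_norm u) (comb_norm e)).
    apply: contrapT => h; apply: hne => m; apply: contrapT => hy; apply: h.
    exists m => y ym; apply: contrapT => hm'; apply: hy; exists y; split=> // m'.
    apply: contrapT => hw; apply: hm'; exists m' => w wm' hyw.
    by apply: hw; exists w.
  have sph n v : fsphere x n v -> tail_sphere x n v.
    by move=> [nv v1]; split=> //; exact: ftail_closed_span.
  have : G set0; last exact: filter_not_empty.
  have h1 := unif d d0.
  have h2 : G [set t | ~ okpair (1 + d) N t.1 t.2].
    apply: FG; exists m => y ym _; have [m' hm'] := hm y (sph _ _ ym).
    exists (maxn m' (supp_end x y)) => w wm _ /= ok.
    have wm1 := fsphereW (leq_maxl _ _) wm.
    have wm2 := fsphereW (leq_maxr _ _) wm.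
    apply: (hm' w (sph _ _ wm1)) => /=; split.
      split.
        move=> [[|[|i]] hi] //=; split.
        - exact: fsphere_neq0 ym.
        - exists (coef x y); apply: coef_finite_expansion => //.
          by case: ym => h _; exact: ftailW h.
        - exact: fsphere_neq0 wm1.
        - exists (coef x w); apply: coef_finite_expansion => //.
          by case: wm1 => h _; exact: ftailW h.
      move=> [[|[|i]] hi] [[|[|j]] hj] //= _.
      by apply: (supp_end_successive hx (proj1 ym) (proj1 wm2)).
    move=> a; rewrite eN /comb_norm !big_ord_recl big_ord0 /= addr0.
    exact: ok.
  by apply: filterS (filterI h1 h2) => t [].
have Nlp : N = lp2 p.
  apply/funext => a; apply/funext => b.
  have := hlp 2%N E e ebasis easym (fun i => if i == ord0 then a else b).
  rewrite eN lp_norm2// /= invr1 !mul1r => h.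
  by apply/esym/le_anti.
have : G set0; last exact: filter_not_empty.
have h1 := unif eps e0; rewrite Nlp in h1.
have h2 : G [set t | B t.1 t.2] by apply: FG; exists 0%N => y _ _; exists 0%N.
by apply: filterS (filterI h1 h2) => t [].
Qed.

(** In an asymptotic game the first player may choose the tails so that the
    vectors of the second player satisfy the requirement [M]. *)
Lemma alternating_play (T : Type) (S : nat -> set T) (P : seq T -> Prop)
    (M : seq T -> nat) (n : nat) (acc : seq T) :
  Defs.alternating S P n acc ->
  exists s, [/\ size s = n, P (acc ++ s) &
    forall y0 i, (i < n)%N -> S (M (acc ++ take i s)) (nth y0 s i)].
Proof.
elim: n acc => [|n ih] acc /=; first by exists [::]; rewrite cats0.
move=> /(_ (M acc))[y [Sy /ih[s [sn Ps hs]]]]; exists (y :: s).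
split=> [|| y0 [|i] /= ni]; first by rewrite /= sn.
- by rewrite -cat_rcons.
- by rewrite cats0.
by rewrite -cat_rcons; exact: hs.
Qed.

Theorem asymptotic_pair_asymptotic_lp :
  asymptotic_pair x (lp2 p) -> asymptotic_lp x 1 p.
Proof.
move=> hp n E e ebasis easym a.
suff key (d : R) : 0 < d -> comb_norm e a <= (1 + d) ^+ 4 * lp_norm p a /\
    lp_norm p a <= (1 + d) ^+ 4 * comb_norm e a.
  rewrite invr1 !mul1r; apply/andP; split.
    apply: le_approx4 => [|d d0]; first exact: normr_ge0.
    exact: (key d d0).2.
  apply: le_approx4 => [|d d0]; first exact: lp_norm_ge0.
  exact: (key d d0).1.
move=> d0; have d1 : 1 <= 1 + d by lra.
have [M hM] := far_requirement hx p1 d0 hp.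
have [s [sn [[sb _] sE] sM]] := alternating_play M (easym d d0).
pose u i := nth 0 s i.
have take_mk i : (i < n)%N -> take i s = mkseq u i.
  move=> ni; apply: (@eq_from_nth _ 0).
    by rewrite size_mkseq size_take sn ni.
  move=> j; rewrite size_take sn ni => ji.
  by rewrite nth_take// nth_mkseq.
have hu i : (i < n)%N -> fsphere x (M (mkseq u i)) (u i).
  move=> ni; have := sM 0 i ni; rewrite cat0s take_mk// => -[cs u1].
  split=> //; split; first by move=> j; exact: closed_span_coef cs.
  have [_ [b hb]] := sb (Ordinal ni).
  exact: (finite_expansion_ftail hx hb).2.
have [_ hu'] := hM n u hu.
have g1 i : tolerance d i <= 1 + d.
  by rewrite lerD2l ler_pdivrMr// ler_peMr ?ler1n// ltW.
have /(_ a)/andP[h1 h2] := hu' n (fun i => i) (1 + d)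
  (fun i j ij => ij) (fun i => ltn_ord i) d1 (fun i => g1 i).
have /andP[h3 h4] := sE a.
have q0 : 0 < 1 + d by lra.
rewrite ler_pdivrMl// in h1; rewrite ler_pdivrMl// in h3.
rewrite /= in h3 h4.
have L0 : 0 <= lp_norm p a by exact: lp_norm_ge0.
have C0 : 0 <= comb_norm e a by exact: normr_ge0.
have w (r : R) : 0 <= r -> (1 + d) * ((1 + d) * r) <= (1 + d) ^+ 4 * r.
  by move=> r0; rewrite mulrA -expr2 ler_wpM2r// ler_weXn2l.
split; (apply: le_trans (w _ _) => //).
  by apply: le_trans h3 _; rewrite ler_pM2l.
by apply: le_trans h1 _; rewrite ler_pM2l.
Qed.

End Converse.

(** * Good branches *)

Section GoodBranchExists.
Context (R : realType) (X : completeNormedModType R) (x : nat -> X).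
Hypothesis hx : schauder_basis x.
Context (T : {fset nat} -> X).
Hypothesis T1 : normalized_tree T.
Hypothesis Tb : block_tree x T.

(** Below every node there are nodes arbitrarily far out, so a branch can be
    chosen to meet any requirement [M]. *)
Lemma far_branch (M : seq X -> nat) : exists k : nat -> nat,
  (forall i j, (i < j)%N -> (k i < k j)%N) /\
  forall i, fsphere x (M (mkseq (branch T k) i)) (branch T k i).
Proof.
pose F (s : seq nat) : {fset nat} := [fset z in s]%fset.
pose c (s : seq nat) := (\max_(i <- F s) i.+1)%N.
pose nodes (s : seq nat) := mkseq (fun j => T (F (take j.+1 s))) (size s).
have next s : exists n, fsphere x (M (nodes s)) (T ((c s + n)%N |` F s)%fset).
  exists (M (nodes s)).
  apply: (block_sequence_fsphere hx (Tb (F s))) => n; apply: T1.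
  by apply/fset0Pn; exists (c s + n)%N; rewrite fset1U1.
have [g hg] := choice next.
have [k hk] := history_recursion (fun s => c s + g s)%N.
have memF s z : (z \in F s) = (z \in s) by rewrite inE.
have FE i : F (mkseq k i) = [fset k j | j in iota 0 i]%fset.
  by apply/fsetP => z; rewrite memF; apply/mapP/imfsetP => -[j /= ji ->]; exists j.
have FS i : [fset k j | j in iota 0 i.+1]%fset = (k i |` F (mkseq k i))%fset.
  rewrite -FE; apply/fsetP => z.
  by rewrite in_fset1U !memF mkseqS mem_rcons inE.
have kc i : (c (mkseq k i) <= k i)%N by rewrite [k i]hk leq_addr.
exists k; split=> [i j ij|i].
  apply: leq_trans (kc j).
  apply: (@leq_bigmax_seq _ (enum_fset (F (mkseq k j))) xpredT (fun i => i.+1)).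
    rewrite -[_ \in _]/(k i \in F (mkseq k j)) memF.
    by apply/mapP; exists i; rewrite ?mem_iota.
  by [].
have -> : mkseq (branch T k) i = nodes (mkseq k i).
  rewrite /nodes size_mkseq; apply: (@eq_from_nth _ 0); rewrite ?size_mkseq// => j ji.
  rewrite !nth_mkseq// /branch -FE; congr (T (F _)).
  apply: (@eq_from_nth _ 0%N); first by rewrite size_take !size_mkseq; case: ifP; lia.
  rewrite size_mkseq => l lj; rewrite nth_take// !nth_mkseq//.
  exact: leq_trans ji.
by rewrite /branch FS [k i]hk; exact: hg.
Qed.

Theorem asymptotic_pair_good_branch (p : \bar R) :
  (1%:E <= p)%E -> asymptotic_pair x (lp2 p) -> has_good_branch T.
Proof.
move=> p1 hp; have [M hM] := far_requirement hx p1 ltr01 hp.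
have [k [kmon hk]] := far_branch M; exists k; split=> //.
set y := branch T k in hk *.
have y0 i : fsphere x 0 (y i) by exact: fsphereW (hk i).
have hy n := hM n y (fun i _ => hk i).
split=> [i||n a].
- by have [] := y0 i.
- apply: (far_sequence_basic hx y0) => i j ij.
  by have [h _] := hy j.+1; exact: h.
exists (lp_norm p a) => eps e0; set L := lp_norm p a.
have L0 : 0 <= L by exact: lp_norm_ge0.
pose K := Num.truncn (2 * L / eps).
exists K => l lmon lK.
set C := `|\sum_(i < n) _|.
pose d : R := K.+1%:R^-1.
have TE : tolerance 1 K = 1 + d by rewrite /tolerance div1r.
have d0 : 0 <= d by rewrite invr_ge0.
have d1 : d <= 1 by rewrite invf_le1 ?ltr0n// ler1n.
have dL : 2 * L * d < eps.
  by rewrite ltr_pdivrMr// [eps * _]mulrC -ltr_pdivrMr// truncnS_gt.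
have [_ h] := hy (\max_(i < n) l i).+1.
have lmax i : (l i < (\max_(i < n) l i).+1)%N by rewrite ltnS; exact: leq_bigmax.
have hL : equivalent_to_lpn (1 + d) p (y \o l).
  apply: h => //; first by rewrite lerDl.
  by move=> i; rewrite -TE; apply: tolerance_decr.
have /andP[h1 h2] : (1 + d)^-1 * L <= C <= (1 + d) * L := hL a.
rewrite ler_pdivrMl in h1; last by lra.
have C0 : 0 <= C by exact: normr_ge0.
have h3 : d * C <= d * (2 * L).
  rewrite ler_wpM2l//; apply: le_trans h2 _; rewrite ler_wpM2r//; lra.
have h4 : 0 <= d * L by exact: mulr_ge0.
rewrite ltr_norml; lra.
Qed.

End GoodBranchExists.

Unset Implicit Arguments.

Theorem theoremA (R : realType) (X : completeNormedModType R) (x : nat -> X)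
    (hx : schauder_basis x) :
  ((forall T : {fset nat} -> X,
      normalized_tree T -> block_tree x T -> has_good_branch T) <->
   (exists p : \bar R, (1%:E <= p)%E /\ asymptotic_lp x 1 p)) /\
  (forall p : \bar R, (1%:E <= p)%E -> asymptotic_lp x 1 p ->
     forall eps : R, 0 < eps ->
       exists y : nat -> X, equivalent_to_lp (1 + eps) p y).
Proof.
split; last first.
  move=> p p1 /(asymptotic_lp_pair hx p1) hp.
  exact: asymptotic_pair_copies hp.
split=> [good|[p [p1 /(asymptotic_lp_pair hx p1) hp]] T T1 Tb].
  have [N hN] := good_branches_asymptotic_pair hx good.
  have [p [p1 hp]] := asymptotic_pair_lp hx hN.
  by exists p; split=> //; exact: asymptotic_pair_asymptotic_lp.
exact: asymptotic_pair_good_branch hp.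
Qed.
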